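(* Let $k$ be an algebraically closed field, $R=k[[x,y]]$, and let $C=\sum_{i=1}^r n_iC_i$ be a non-reduced germ of plane curve on $\mathrm{Spec}(R)$, where $C_1,\dots,C_r$ are its integral components. Let $\mathcal C$ be the configuration of infinitely near points associated with a log resolution of $C$. For each $i\in\{1,\dots,r\}$, pick $n_i$ curves $C_{i1},\dots,C_{in_i}$ defined by $n_i$ curvettes at the maximal point $P_j$ (where $j=j(i)$) of $\mathcal C$ through which the strict transform of $C_i$ passes, and such that their strict transforms meet $E_j$ at different free points. Then $$\mathrm{lct}(C)=\min\{1/n_1,\,1/n_2,\dots,1/n_r,\ \mathrm{lct}(C')\},$$ where $C'$ is the reduced curve $\sum_{1\le i\le r}\sum_{1\le l\le n_i}C_{il}$. Therefore a formula for the log-canonical threshold of singular reduced germs of plane curve provides, in fact, a formula for the log-canonical threshold of any (reduced or non-reduced) singular plane curve.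
   Context: A log resolution of a germ of curve $D$ on $X_0=\mathrm{Spec}(R)$ is a composition $\pi:X=X_m\to\cdots\to X_0$ of blowing-ups $\pi_j:X_j\to X_{j-1}$ centered at closed points $P_j$ ($P_1$ is the closed point of $X_0$) such that $\pi^*D$ has simple normal crossing support; its configuration is $\mathcal C=\{P_1,\dots,P_m\}$, and $E_j$ denotes the exceptional divisor of $\pi_j$ and also its strict transform on $X$. Points of $\mathcal C$ are ordered by: $P_k\gtrsim P_j$ if $k\ge j$ and $X_{k-1}\to X_{j-1}$ maps $P_k$ to $P_j$. For a curve $D$ with log resolution $\pi$ and rational $t>0$, the multiplier ideal is $\mathcal J(X_0,tD)=\pi_*\mathcal O_X(K_{X|X_0}-\lfloor t\,\pi^*D\rfloor)$, with $K_{X|X_0}$ the relative canonical divisor, and $\mathrm{lct}(D)$ is the smallest positive rational number $t$ with $\mathcal J(X_0,tD)\ne R$. A curvette at $P_j\in\mathcal C$ is an irreducible $\varphi\in R$ defining a curve different from all the $C_i$ whose strict transform on $X$ is nonsingular and meets $E_j$ transversally at a regular point (of the exceptional divisor). A free point of $E_j$ is one lying on no other exceptional component.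
   Formalization: The chosen curvettes are required to meet E_j at different free points also when they belong to different components C_i with the same j(i), not only for each i separately; without this the formula fails, e.g. for x²y(x+y) with three mutually tangent curvettes. *)

(* Defs.v *)
From HB Require Import structures.
From mathcomp Require Import all_boot all_order all_algebra.
From mathcomp Require Import boolp classical_sets.

Set Implicit Arguments.
Unset Strict Implicit.
Unset Printing Implicit Defensive.

Import Order.TTheory GRing.Theory Num.Theory.
Local Open Scope ring_scope.

(* The formal power series ring k[[x,y]]: coef f i j is the coefficient of
   x^i y^j in f. *)
Record pseries2 (k : Type) := PSeries2 { coef : nat -> nat -> k }.
Coercion coef : pseries2 >-> Funclass.

Lemma pseries2P (k : Type) (f g : pseries2 k) :
  (forall i j, f i j = g i j) -> f = g.
Proof.
case: f g => [f] [g] /= fg; congr PSeries2.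
by apply/funext => i; apply/funext => j.
Qed.

HB.instance Definition _ (k : Type) := gen_eqMixin (pseries2 k).
HB.instance Definition _ (k : Type) := gen_choiceMixin (pseries2 k).

Section PSeries2Ring.
Variable k : comNzRingType.
Implicit Types f g h : pseries2 k.

Definition ps_zero : pseries2 k := PSeries2 (fun _ _ => 0).
Definition ps_opp f : pseries2 k := PSeries2 (fun i j => - f i j).
Definition ps_add f g : pseries2 k := PSeries2 (fun i j => f i j + g i j).
Definition ps_const (c : k) : pseries2 k :=
  PSeries2 (fun i j => c *+ ((i == 0) && (j == 0))%N).
Definition ps_mul f g : pseries2 k := PSeries2 (fun i j =>
  \sum_(a < i.+1) \sum_(b < j.+1) f a b * g (i - a)%N (j - b)%N).

Fact ps_addA : associative ps_add.
Proof. by move=> f g h; apply: pseries2P => i j /=; rewrite addrA. Qed.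
Fact ps_addC : commutative ps_add.
Proof. by move=> f g; apply: pseries2P => i j /=; rewrite addrC. Qed.
Fact ps_add0 : left_id ps_zero ps_add.
Proof. by move=> f; apply: pseries2P => i j /=; rewrite add0r. Qed.
Fact ps_addN : left_inverse ps_zero ps_opp ps_add.
Proof. by move=> f; apply: pseries2P => i j /=; rewrite addNr. Qed.

HB.instance Definition _ := GRing.isZmodule.Build (pseries2 k)
  ps_addA ps_addC ps_add0 ps_addN.

Let agree (N : nat) (p : {poly {poly k}}) f :=
  forall i j, (i < N)%N -> (j < N)%N -> p`_i`_j = f i j.
Let trunc (N : nat) f : {poly {poly k}} := \poly_(i < N) \poly_(j < N) f i j.

Let truncP N f : agree N (trunc N f) f.
Proof. by move=> i j iN jN; rewrite coef_poly iN coef_poly jN. Qed.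

Let agreeM N p q f g : agree N p f -> agree N q g -> agree N (p * q) (ps_mul f g).
Proof.
move=> pf qg i j iN jN; rewrite coefM coef_sum; apply: eq_bigr => a _.
rewrite coefM; apply: eq_bigr => b _.
have ai : (a <= i)%N by rewrite -ltnS ltn_ord.
have bj : (b <= j)%N by rewrite -ltnS ltn_ord.
rewrite pf ?qg ?(leq_ltn_trans ai) ?(leq_ltn_trans bj) //;
  by [apply: leq_ltn_trans iN; apply: leq_subr | apply: leq_ltn_trans jN; apply: leq_subr].
Qed.

Let agree_eq f g :
  (forall N, exists2 p, agree N p f & agree N p g) -> f = g.
Proof.
move=> fg; apply: pseries2P => i j; have [p pf pg] := fg (maxn i j).+1.
by rewrite -pf ?pg // ltnS ?leq_maxl ?leq_maxr.
Qed.

Fact ps_mulA : associative ps_mul.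
Proof.
move=> f g h; apply: agree_eq => N.
exists (trunc N f * (trunc N g * trunc N h)); first by do ?apply: agreeM.
by rewrite mulrA; do ?apply: agreeM.
Qed.
Fact ps_mulC : commutative ps_mul.
Proof.
move=> f g; apply: agree_eq => N.
exists (trunc N f * trunc N g); first exact: agreeM.
by rewrite mulrC; apply: agreeM.
Qed.
Fact ps_mul1 : left_id (ps_const 1) ps_mul.
Proof.
move=> f; apply: agree_eq => N; exists (1 * trunc N f); last by rewrite mul1r.
apply: agreeM => // i j _ _; rewrite coef1 /=.
by case: i => [|i]; rewrite ?coef1 ?coef0.
Qed.
Fact ps_mulDl : left_distributive ps_mul ps_add.
Proof.
move=> f g h; apply: pseries2P => i j /=; rewrite -big_split /=.
by apply: eq_bigr => a _; rewrite -big_split; apply: eq_bigr => b _ /=; rewrite mulrDl.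
Qed.
Fact ps_1neq0 : ps_const 1 != 0 :> pseries2 k.
Proof.
apply/eqP => /(congr1 (fun f : pseries2 k => f 0%N 0%N)) /= /eqP.
by rewrite oner_eq0.
Qed.

HB.instance Definition _ := GRing.Zmodule_isComNzRing.Build (pseries2 k)
  ps_mulA ps_mulC ps_mul1 ps_mulDl ps_1neq0.

Definition ps_unit : {pred pseries2 k} :=
  fun f => `[< exists g : pseries2 k, g * f = 1 >].
Definition ps_inv f : pseries2 k :=
  if f \in ps_unit then xget 0 [set g | g * f = 1]%classic else f.

Fact ps_mulV : {in ps_unit, left_inverse 1 ps_inv *%R}.
Proof.
move=> f fU; rewrite /ps_inv fU.
exact: (xgetPex 0 (asboolW fU : exists g, [set g | g * f = 1]%classic g)).
Qed.
Fact ps_unitP f g : g * f = 1 -> ps_unit f.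
Proof. by move=> gf; apply/asboolP; exists g. Qed.
Fact ps_inv_out : {in [predC ps_unit], ps_inv =1 id}.
Proof. by move=> f; rewrite inE /= /ps_inv => /negbTE ->. Qed.

HB.instance Definition _ := GRing.ComNzRing_hasMulInverse.Build (pseries2 k)
  ps_mulV ps_unitP ps_inv_out.

End PSeries2Ring.

Section Algebra.
Variable A : comUnitRingType.
Implicit Types a b z : A.

Definition irreducible_elt a : Prop :=
  [/\ a != 0, a \isn't a GRing.unit &
      forall b c, a = b * c -> b \is a GRing.unit \/ c \is a GRing.unit].

Definition associated a b : Prop := exists2 w, w \is a GRing.unit & b = w * a.

Definition divides a b : Prop := exists c, b = a * c.

(* Multiplicity in div(a) of the prime divisor with local equation z; junk
   value 0 when there is none, e.g. for a = 0. *)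
Definition ord_along z a : nat :=
  xget 0%N [set e | divides (z ^+ e) a /\ ~ divides (z ^+ e.+1) a]%classic.

End Algebra.

Section PlaneCurves.
Variable k : closedFieldType.
Local Notation R := (pseries2 k).
Implicit Types f g h z : R.

Definition psX : R := PSeries2 (fun i j => ((i == 1) && (j == 0))%N%:R).
Definition psY : R := PSeries2 (fun i j => ((i == 0) && (j == 1))%N%:R).

(* f(g,h), for g and h in the maximal ideal: then g^a h^b only has terms of
   total degree at least a + b, so the finite sum below is the whole sum. *)
Definition ps_subst f g h : R := PSeries2 (fun i j =>
  \sum_(a < (i + j).+1) \sum_(b < (i + j).+1) f a b * (g ^+ a * h ^+ b) i j).

Definition ps_dx f : R := PSeries2 (fun i j => f i.+1 j *+ i.+1).
Definition ps_dy f : R := PSeries2 (fun i j => f i j.+1 *+ j.+1).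
Definition jacobian g h : R := ps_dx g * ps_dy h - ps_dy g * ps_dx h.

Definition nonsingular g : Prop :=
  g 0%N 0%N = 0 /\ (g 1%N 0%N != 0 \/ g 0%N 1%N != 0).
Definition singular g : Prop :=
  [/\ g 0%N 0%N = 0, g 1%N 0%N = 0 & g 0%N 1%N = 0].
Definition transversal g h : Prop :=
  [/\ g 0%N 0%N = 0, h 0%N 0%N = 0 &
      g 1%N 0%N * h 0%N 1%N - g 0%N 1%N * h 1%N 0%N != 0].

(* The exceptional curve of the blowing-up of a closed point with local
   coordinates (x,y) is P^1(k): Some a is the direction y = a x and None the
   direction x = 0. At the point of direction d we use the local coordinates
   (u,v) with x = u, y = u (v + a) if d = Some a, and x = u v, y = u if
   d = None; in both cases u = 0 is the exceptional curve, and blowup d f is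
   the pull-back of f to the completed local ring k[[u,v]] at that point. *)
Definition direction : Type := option k.

Definition blowup (d : direction) f : R :=
  match d with
  | Some a => ps_subst f psX (psX * (psY + ps_const a))
  | None => ps_subst f (psX * psY) psX
  end.

(* Points infinitely near to the closed point of Spec R (itself [::]), encoded
   by the successive directions; q is infinitely near to p iff prefix p q. *)
Definition inpoint : Type := seq direction.
Implicit Types (p q : inpoint) (C : seq inpoint).

Definition pullback p f : R := foldl (fun g d => blowup d g) f p.

Definition strict1 (d : direction) f : R :=
  xget 0 [set h | blowup d f = psX ^+ ord_along psX (blowup d f) * h]%classic.

(* Local equation at p of the strict transform of f = 0. *)
Definition strict p f : R := foldl (fun g d => strict1 d g) f p.

(* A local equation defines a germ passing through the point. *)
Definition through f : Prop := f \isn't a GRing.unit.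

(* q is a closed point of the surface obtained from Spec R by blowing up the
   points in C. *)
Definition closed_point C q : Prop :=
  q \notin C /\ forall p, prefix p q -> p != q -> p \in C.

Definition configuration C : Prop :=
  C != [::] /\
  forall i, (i < size C)%N -> closed_point (take i C) (nth [::] C i).

(* Local equation at q of the strict transform of the exceptional curve E_p
   of the blowing-up of p (1 if q does not lie over p). *)
Definition exc p q : R :=
  if prefix p q && (p != q) then strict (drop (size p).+1 q) psX else 1.

(* A free point of E_p, on the surface X obtained by blowing up C. *)
Definition free_point C p q : Prop :=
  [/\ closed_point C q, through (exc p q) &
      forall p', p' \in C -> p' != p -> ~ through (exc p' q)].

(* Multiplicity of E_p in the pull-back of div(f), and in the relative
   canonical divisor, which is the divisor of the Jacobian. They are computed
   at one point of E_p; any other direction gives the same values. *)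
Definition mult_exc p f : nat := ord_along psX (pullback (rcons p (Some 0)) f).
Definition canon_exc p : nat :=
  let p' := rcons p (Some 0) in
  ord_along psX (jacobian (pullback p' psX) (pullback p' psY)).

(* A germ of curve \sum_i n_i C_i with integral components C_i, i : I, is given
   by equations c i of the C_i and by its multiplicities n i; it is reduced
   when n = 1. *)
Definition components (I : finType) (c : I -> R) : Prop :=
  (forall i, irreducible_elt (c i)) /\
  (forall i i', i != i' -> ~ associated (c i) (c i')).

(* The irreducible components of the support of the total transform are the
   E_p, p \in C (inl p), and the strict transforms of the C_i (inr i). *)
Definition in_support (I : finType) C (D : inpoint + I) : Prop :=
  if D is inl p then p \in C : Prop else True.
Definition local_eq (I : finType) (c : I -> R) q (D : inpoint + I) : R :=
  match D with inl p => exc p q | inr i => strict q (c i) end.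

Definition snc_at (I : finType) C (c : I -> R) q : Prop :=
  let meets (D : inpoint + I) := in_support C D /\ through (local_eq c q D) in
  [/\ forall D, meets D -> nonsingular (local_eq c q D),
      forall D D', meets D -> meets D' -> D != D' ->
        transversal (local_eq c q D) (local_eq c q D') &
      forall D D' D'', meets D -> meets D' -> meets D'' ->
        ~ [/\ D != D', D' != D'' & D != D'']].

Definition log_resolution (I : finType) C (c : I -> R) : Prop :=
  configuration C /\ forall q, closed_point C q -> snc_at C c q.

(* Global sections of O_X(K_{X|X_0} - floor(t pi^*D)), D = \sum_i n_i C_i.
   This divisor is <= 0 off the exceptional locus, so that its sections are
   in R and its prime components to be tested are the E_p and the C_i. *)
Definition multiplier_ideal (I : finType) C (c : I -> R) (n : I -> nat)
    (t : rat) : set R :=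
  [set h | h = 0 \/
    (forall p, p \in C ->
       Num.floor (t * (\sum_i n i * mult_exc p (c i))%N%:R)
         <= (mult_exc p h)%:Z + (canon_exc p)%:Z) /\
    (forall i, Num.floor (t * (n i)%:R) <= (ord_along (c i) h)%:Z)]%classic.

(* t = lct(D); the value must not depend on the log resolution. *)
Definition is_lct (I : finType) (c : I -> R) (n : I -> nat) (t : rat) : Prop :=
  (exists C, log_resolution C c) /\
  forall C, log_resolution C c ->
    [/\ 0 < t, multiplier_ideal C c n t <> setT &
        forall s, 0 < s -> multiplier_ideal C c n s <> setT -> t <= s].

(* p is the maximal point of C through which the strict transform of the
   branch f = 0 passes. *)
Definition maximal_point C f p : Prop :=
  [/\ p \in C, through (strict p f) &
      forall q, q \in C -> through (strict q f) -> prefix p q -> q = p].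

(* phi is a curvette at p, with respect to the curve with components c. *)
Definition curvette (I : finType) C (c : I -> R) p (phi : R) : Prop :=
  [/\ irreducible_elt phi,
      forall i, ~ associated (c i) phi,
      forall q, closed_point C q -> through (strict q phi) ->
        nonsingular (strict q phi) &
      exists2 q, free_point C p q & transversal (strict q phi) (exc p q)].

End PlaneCurves.

(* Main.v *)
(** The ideal of tC contains 1 iff t ord_E(C) < ord_E(K) + 1 for every
exceptional curve E of the log resolution and t n_i < 1 for every i. At a
point where the total transform has simple normal crossings, these inequalities
pass to the exceptional curve of the next blowing-up, because its log
discrepancy is the sum of those of the two local branches. Hence they hold for
all divisors over the closed point as soon as they hold on one log resolution,
and the threshold may be computed on any of them.

The given configuration C also resolves the curvettes, and ord_E(f_i) =
ord_E(g_il) for all E in C: going down the infinitely near points, the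
multiplicity of a branch and its contacts with the exceptional curves through a
point are determined by those at the next point. So the two sets of
inequalities differ only by t n_i < 1.

That an irreducible germ passes through a single chain of infinitely near points
follows from Weierstrass division: a factor of the strict transform is the
strict transform of a factor. *)

From HB Require Import structures.
Require Import Defs.
From mathcomp Require Import all_boot all_order all_algebra.
From mathcomp Require Import boolp classical_sets.
From mathcomp Require Import zify ring.

Set Implicit Arguments.
Unset Strict Implicit.
Unset Printing Implicit Defensive.

Import Order.TTheory GRing.Theory Num.Theory.
Local Open Scope ring_scope.

(* Disambiguates from finset.transversal. *)
Local Notation transversal := Defs.transversal.

(** * Weierstrass division *)

(** [is_lct] demands one value on all log resolutions, so independence of the resolution cannot be
    bypassed, even though the statement fixes a single [C]. Geometry is read off coefficients: a
    chart of the blowing-up is a linear change of coordinates followed by (x, y) -> (x, xy), and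
    after this substitution the coefficient of x^n is the homogeneous part of degree n. Multiplicity
    at a point thus becomes order along the exceptional curve, and the initial form becomes the
    trace of the strict transform on that curve. The step that is not formal is unibranchness. A
    factorization of a strict transform takes place in the completed local ring of a point above,
    which is larger than the image of k[[x,y]], so a factor need not come from below. Weierstrass
    division turns it into a polynomial in v up to a unit, and a power of u then makes it the
    pull-back of a series in x and y. *)

Section FixedPoint.
Variables (k : comNzRingType) (wt : nat -> nat -> nat).
Variable Phi : pseries2 k -> pseries2 k.
Hypothesis Phi_contracts : forall N (f g : pseries2 k),
  (forall i j, (wt i j < N)%N -> f i j = g i j) ->
  forall i j, (wt i j < N.+1)%N -> Phi f i j = Phi g i j.

(** After [n] steps the iterates of [Phi] from 0 no longer change in weight below [n], so every
    coefficient is eventually constant. A weight level may contain infinitely many monomials; this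
    lets the x-degree serve as weight for Weierstrass division, as the total degree does for
    inverses. *)
Lemma contraction_fixpoint : exists f, Phi f = f.
Proof.
pose Z n := iter n Phi 0.
have ZS n i j : (wt i j < n)%N -> Z n i j = Z n.+1 i j.
  elim: n i j => [//|n IH] i j lt_n; exact: (Phi_contracts IH).
have Zge n m i j : (wt i j < n)%N -> (n <= m)%N -> Z n i j = Z m i j.
  move=> lt_n; elim: m => [|m IH]; first by rewrite leqn0 => /eqP ->.
  rewrite leq_eqVlt => /predU1P[-> //|]; rewrite ltnS => le_nm.
  by rewrite IH // ZS //; apply: leq_trans le_nm.
pose f := PSeries2 (fun i j => Z (wt i j).+1 i j).
exists f; apply: pseries2P => i j /=.
rewrite (@Phi_contracts (wt i j) f (Z (wt i j))) // => i' j' lt'.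
exact: Zge.
Qed.

Lemma contraction_unique f g : Phi f = f -> Phi g = g -> f = g.
Proof.
move=> ff gg; apply: pseries2P => i j.
suff: forall N i j, (wt i j < N)%N -> f i j = g i j by exact.
elim=> // N IH i' j' lt'; rewrite -ff -gg; exact: Phi_contracts lt'.
Qed.

End FixedPoint.

Section PowerSeries.
Variable k : comNzRingType.
Local Notation R := (pseries2 k).
Implicit Types f g h : R.

Lemma coef_add f g i j : (f + g) i j = f i j + g i j. Proof. by []. Qed.
Lemma coef_opp f i j : (- f) i j = - f i j. Proof. by []. Qed.
Lemma coef_one i j : (1 : R) i j = ((i == 0) && (j == 0))%N%:R.
Proof. by []. Qed.
Lemma coef_mul f g i j :
  (f * g) i j = \sum_(a < i.+1) \sum_(b < j.+1) f a b * g (i - a)%N (j - b)%N.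
Proof. by []. Qed.

Lemma coef_mul00 f g : (f * g) 0%N 0%N = f 0%N 0%N * g 0%N 0%N.
Proof. by rewrite coef_mul !big_ord_recl !big_ord0 !addr0. Qed.

Lemma coef_mul0 f g j :
  (f * g) 0%N j = \sum_(b < j.+1) f 0%N b * g 0%N (j - b)%N.
Proof. by rewrite coef_mul big_ord_recl big_ord0 addr0. Qed.

Lemma coef_const_mul c f i j : (ps_const c * f) i j = c * f i j.
Proof.
rewrite coef_mul big_ord_recl [X in X + _]big_ord_recl /= !subn0.
rewrite !big1 ?addr0 // => [a _|b _].
  by rewrite big1 // => b _; rewrite /= mulr0n mul0r.
by rewrite /= mulr0n mul0r.
Qed.

(** Only coefficients of [f] of weight below [wt i j] contribute to the coefficient of [f * m] at
    [i], [j]: multiplication by [m] raises the weight. *)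
Lemma contraction_mulr (m : R) (wt : nat -> nat -> nat) :
  (forall i j a b, (a <= i)%N -> (b <= j)%N ->
     m (i - a)%N (j - b)%N != 0 -> (wt a b < wt i j)%N) ->
  forall N f g, (forall i j, (wt i j < N)%N -> f i j = g i j) ->
  forall i j, (wt i j < N.+1)%N -> (f * m) i j = (g * m) i j.
Proof.
move=> mP N f g fg i j lt_N; rewrite !coef_mul.
apply: eq_bigr => a _; apply: eq_bigr => b _.
have [->|m0] := eqVneq (m (i - a)%N (j - b)%N) 0; first by rewrite !mulr0.
by rewrite fg //; apply: leq_trans (lt_N : (_ <= N)%N); apply: mP;
  rewrite // -ltnS ltn_ord.
Qed.

End PowerSeries.

Section Units.
Variable k : fieldType.
Local Notation R := (pseries2 k).
Implicit Types f g h : R.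

Lemma ps_unitE f : (f \is a GRing.unit) = (f 0%N 0%N != 0).
Proof.
apply/idP/idP => [fU|f0].
  apply/eqP => f0; have := coef_mul00 f f^-1.
  by rewrite divrr // f0 mul0r => /eqP; rewrite /= oner_eq0.
(* Geometric series: a solution of [g = 1 + g * m] inverts [1 - m], and [m] has no constant term, so
   it raises the total degree. *)
pose c := f 0%N 0%N; pose m : R := 1 - ps_const c^-1 * f.
have m00 : m 0%N 0%N = 0.
  by rewrite coef_add coef_opp coef_const_mul mulVf // subrr.
have [|g gP] := @contraction_fixpoint k addn (fun g => 1 + g * m).
  move=> N g h gh i j lt_N; rewrite !coef_add; congr (_ + _).
  apply: contraction_mulr gh _ _ lt_N => i' j' a b ai bj m0.
  rewrite ltnNge; apply: contraNN m0 => le_ij.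
  have -> : (i' - a = 0)%N by lia.
  have -> : (j' - b = 0)%N by lia.
  by rewrite m00.
suff : (g * ps_const c^-1) * f = 1 by move/(@ps_unitP _ _ _).
by rewrite -mulrA -[_ * f](subKr 1) -/m mulrBr mulr1 -{1}gP addrK.
Qed.

Lemma nonunitE f : f \isn't a GRing.unit <-> f 0%N 0%N = 0.
Proof. by rewrite ps_unitE negbK; split=> /eqP. Qed.

End Units.

Definition seq_ord (k : nmodType) (s : nat -> k) (m : nat) : Prop :=
  s m != 0 /\ forall m', (m' < m)%N -> s m' = 0.

Lemma seq_ord_inj (k : nmodType) (s : nat -> k) m m' :
  seq_ord s m -> seq_ord s m' -> m = m'.
Proof.
move=> [nz lo] [nz' lo']; case: (ltngtP m m') => // lt.
- by rewrite lo' ?eqxx in nz.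
- by rewrite lo ?eqxx in nz'.
Qed.

Lemma seq_ord_ex (k : nmodType) (s : nat -> k) :
  (exists m, s m != 0) -> exists m, seq_ord s m.
Proof.
move=> ex; exists (ex_minn ex); case: ex_minnP => m nz min; split=> // m' lt.
by apply: contraTeq lt => /min; rewrite -leqNgt.
Qed.

Section Weierstrass.
Variable k : fieldType.
Local Notation R := (pseries2 k).
Implicit Types f g F G Q Z : R.
Variables (G : R) (a : nat).
Hypothesis G_ord : seq_ord (G 0%N) a.

Let hi f : R := PSeries2 (fun i j => f i (a + j)%N).
Let lo f : R := PSeries2 (fun i j => if (j < a)%N then f i j else 0).
Let Ya : R := PSeries2 (fun i j => ((i == 0) && (j == a))%N%:R).

Let mulYa f i j : (Ya * f) i j = if (a <= j)%N then f i (j - a)%N else 0.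
Proof.
rewrite coef_mul big_ord_recl [X in _ + X]big1 ?addr0 /=; last first.
  by move=> x _; rewrite big1 // => y _; rewrite mul0r.
rewrite subn0; case: ifP => aj.
  have aj' : (a < j.+1)%N by [].
  rewrite (bigD1 (Ordinal aj')) //= eqxx mul1r big1 ?addr0 // => y.
  by rewrite -val_eqE /= => /negbTE ->; rewrite mul0r.
by rewrite big1 // => y _; case: eqP (ltn_ord y) => [->|_ _]; rewrite ?mul0r // ltnS aj.
Qed.

Let lo_hi f : f = lo f + Ya * hi f.
Proof.
apply: pseries2P => i j; rewrite coef_add mulYa /= ltnNge.
by case: (leqP a j) => aj; rewrite ?addr0 // add0r subnKC.
Qed.

Let hiD f g : hi (f + g) = hi f + hi g.
Proof. by apply: pseries2P. Qed.
Let hiN f : hi (- f) = - hi f.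
Proof. by apply: pseries2P. Qed.
Let hiYa f : hi (Ya * f) = f.
Proof.
apply: pseries2P => i j; transitivity ((Ya * f) i (a + j)%N) => //.
by rewrite mulYa leq_addr addKn.
Qed.

Let hiU : hi G \is a GRing.unit.
Proof. by rewrite ps_unitE /= addn0; case: G_ord. Qed.

Let M : R := (hi G)^-1 * lo G.

(** The unknown [Z] is the quotient times the unit [hi G]. By [mulG] the product of quotient and
    divisor is [Z * M + Ya * Z], so the remainder has degree below [a] in y exactly when [Z] is
    fixed by [Phi] taken at [hi] of the dividend. *)
Let Phi F Z : R := F - hi (Z * M).

Let mulG Z : Z / hi G * G = Z * M + Ya * Z.
Proof.
rewrite [X in _ * X]lo_hi mulrDr; congr (_ + _); first by rewrite /M !mulrA.
by rewrite mulrCA divrK.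
Qed.

(** Since [a] is the order of [G] on x = 0, [lo G] vanishes there, so [M] is divisible by x.
    Multiplication by [M] raises the x-degree, which [hi] leaves alone. *)
Let Phi_contracts F N f g :
  (forall i j, (i < N)%N -> f i j = g i j) ->
  forall i j, (i < N.+1)%N -> Phi F f i j = Phi F g i j.
Proof.
move=> fg i j lt_N; rewrite /Phi !coef_add !coef_opp; congr (_ - _) => /=.
apply: (@contraction_mulr _ M (fun i _ => i)) fg _ _ lt_N.
move=> {}i {}j s t si _; apply: contraR; rewrite -leqNgt => le_is.
have -> : (i - s = 0)%N by lia.
rewrite /M mulrC coef_mul0 big1 // => y _.
suff -> : lo G 0%N y = 0 by rewrite mul0r.
by rewrite /=; case: ifP => // lt_a; case: G_ord => _ ->.
Qed.

Lemma weierstrass_division F : exists Q, exists r : R,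
  F = Q * G + r /\ forall i j, (a <= j)%N -> r i j = 0.
Proof.
have [Z ZP] := contraction_fixpoint (@Phi_contracts (hi F)).
exists (Z / hi G), (F - Z / hi G * G); split; first by rewrite addrC subrK.
move=> i j aj.
have: hi (F - Z / hi G * G) = 0.
  by rewrite hiD hiN mulG hiD hiYa -{2}ZP /Phi addrCA subrr addr0 subrr.
move/(congr1 (fun f : R => f i (j - a)%N)) => /=.
by rewrite subnKC.
Qed.

Lemma weierstrass_unique Q :
  (forall i j, (a <= j)%N -> (Q * G) i j = 0) -> Q = 0.
Proof.
move=> QG; have QE : Q = Q * hi G / hi G by rewrite mulrK.
suff Z0 : Q * hi G = 0 by rewrite QE Z0 mul0r.
apply: (contraction_unique (@Phi_contracts 0)); last first.
  by apply: pseries2P => i j; rewrite /Phi mul0r /= oppr0 addr0.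
have: hi (Q * G) = 0.
  by apply: pseries2P => i j; apply: QG; apply: leq_addr.
rewrite {1}QE mulG hiD hiYa => /eqP; rewrite addrC addr_eq0 => /eqP ZE.
by rewrite /Phi add0r -ZE.
Qed.

End Weierstrass.

(** * Blowing-up in terms of homogeneous parts *)

Section Forms.
Variable k : closedFieldType.
Local Notation R := (pseries2 k).
Implicit Types (f g h : R) (d : direction k).

(* The homogeneous part of degree n, dehomogenized by x = 1. *)
Definition hform n f : {poly k} := \poly_(j < n.+1) f (n - j)%N j.

Lemma coef_hform n f j :
  (hform n f)`_j = if (j <= n)%N then f (n - j)%N j else 0.
Proof. by rewrite coef_poly ltnS. Qed.

Lemma size_hform n f : (size (hform n f) <= n.+1)%N.
Proof. exact: size_poly. Qed.

Lemma coef_of_hform f i j : f i j = (hform (i + j) f)`_j.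
Proof. by rewrite coef_hform leq_addl addnK. Qed.

Lemma hform_inj f g : (forall n, hform n f = hform n g) -> f = g.
Proof. by move=> fg; apply: pseries2P => i j; rewrite !coef_of_hform fg. Qed.

Lemma hformD n f g : hform n (f + g) = hform n f + hform n g.
Proof.
by apply/polyP => j; rewrite coefD !coef_hform; case: ifP; rewrite ?addr0.
Qed.

Lemma hform1 n : hform n 1 = (n == 0)%N%:R.
Proof.
apply/polyP => j; rewrite coef_hform coef_one -polyC_natr coefC.
case: n => [|n]; first by case: j.
rewrite if_same; case: leqP => // jn; rewrite subn_eq0.
by case: j jn => [|j] //= _; rewrite andbF.
Qed.

Lemma hformM n f g :
  hform n (f * g) = \sum_(s < n.+1) hform s f * hform (n - s) g.
Proof.
apply/polyP => j; rewrite coef_hform coef_sum; case: (leqP j n) => [jn|nj]; last first.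
  rewrite big1 // => s _; apply: nth_default.
  apply: leq_trans nj; apply: leq_trans (size_polyMleq _ _) _.
  have := size_hform s f; have := size_hform (n - s) g.
  by have := ltn_ord s; lia.
under [RHS]eq_bigr do rewrite coefM.
rewrite coef_mul exchange_big [RHS]exchange_big /=; apply: eq_bigr => b _.
have bj : (b <= j)%N by rewrite -ltnS.
rewrite -(big_mkord xpredT (fun a => f a b * g (n - j - a)%N (j - b)%N)).
rewrite -(big_mkord xpredT
  (fun s => (hform s f)`_b * (hform (n - s)%N g)`_(j - b))) /=.
rewrite [RHS](@big_cat_nat _ _ _ b) //=; last by lia.
rewrite [X in _ = _ + X](@big_cat_nat _ _ _ (n - j + b).+1) /=; try lia.
rewrite [X in _ = X + _]big_nat_cond [X in _ = X + _]big1 ?add0r; last first.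
  move=> s /andP[/andP[_ sb] _].
  by rewrite coef_hform leqNgt sb mul0r.
rewrite [X in _ = _ + X]big_nat_cond [X in _ = _ + X]big1 ?addr0; last first.
  move=> s /andP[/andP[bs sn] _].
  by rewrite [X in _ * X]coef_hform ifF ?mulr0 //; lia.
rewrite -[X in _ = \sum_(X <= i < _) _]add0n big_addn -addSn addnK.
apply: eq_big_nat => a /andP[_ an]; rewrite !coef_hform leq_addl addnK.
by rewrite ifT; [congr (_ * g _ _) | ]; lia.
Qed.

Lemma hform_const_mul n c f : hform n (ps_const c * f) = c *: hform n f.
Proof.
apply/polyP => j; rewrite coefZ !coef_hform coef_const_mul.
by case: ifP; rewrite ?mulr0.
Qed.

(** This is f(u, uv): a form of degree n contributes u^n times its dehomogenization. *)
Definition monoidal f : R := PSeries2 (fun i j => (hform i f)`_j).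

Lemma monoidalE f i j : monoidal f i j = (hform i f)`_j. Proof. by []. Qed.

Lemma monoidalD f g : monoidal (f + g) = monoidal f + monoidal g.
Proof. by apply: pseries2P => i j; rewrite coef_add !monoidalE hformD coefD. Qed.

Lemma monoidal1 : monoidal 1 = 1.
Proof.
apply: pseries2P => i j; rewrite monoidalE hform1 -polyC_natr coefC coef_one.
by case: i; case: j.
Qed.

Lemma monoidalM f g : monoidal (f * g) = monoidal f * monoidal g.
Proof.
apply: pseries2P => i j; rewrite monoidalE hformM coef_sum coef_mul.
by apply: eq_bigr => s _; rewrite coefM.
Qed.

Lemma monoidal_inj f g : monoidal f = monoidal g -> f = g.
Proof.
move=> fg; apply: hform_inj => n; apply/polyP => j.
by rewrite -[LHS]monoidalE fg.
Qed.

(* The linear coordinate change that moves the direction d to Some 0. *)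
Definition lin_change d f : R :=
  match d with
  | Some a => PSeries2 (fun i j => (hform (i + j) f \Po ('X + a%:P))`_j)
  | None => PSeries2 (fun i j => f j i)
  end.

Lemma hform_lin_change_Some a n f :
  hform n (lin_change (Some a) f) = hform n f \Po ('X + a%:P).
Proof.
apply/polyP => j; rewrite coef_hform /=; case: leqP => [/subnK -> // | nj].
rewrite nth_default //; apply: leq_trans (size_comp_poly_leq _ _) _.
rewrite size_XaddC muln1; apply: leq_trans nj.
by case: (size _) (size_hform n f).
Qed.

Lemma hform_lin_change_None n f j : (j <= n)%N ->
  (hform n (lin_change None f))`_j = (hform n f)`_(n - j).
Proof. by move=> jn; rewrite !coef_hform jn leq_subr subKn. Qed.

Lemma lin_changeD d f g :
  lin_change d (f + g) = lin_change d f + lin_change d g.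
Proof.
case: d => [a|]; last exact: pseries2P.
by apply: hform_inj => n; rewrite hformD !hform_lin_change_Some hformD comp_polyD.
Qed.

Lemma lin_change1 d : lin_change d 1 = 1.
Proof.
case: d => [a|]; last by apply: pseries2P => i j /=; rewrite andbC.
apply: hform_inj => n; rewrite hform_lin_change_Some hform1 -polyC_natr.
by rewrite comp_polyC.
Qed.

Lemma lin_changeM d f g :
  lin_change d (f * g) = lin_change d f * lin_change d g.
Proof.
case: d => [a|]; last by apply: pseries2P => i j; apply: exchange_big.
apply: hform_inj => n; rewrite hform_lin_change_Some !hformM linear_sum.
by apply: eq_bigr => s _; rewrite /= !hform_lin_change_Some comp_polyM.
Qed.

Definition opp_direction d : direction k := omap -%R d.

Lemma lin_changeK d f : lin_change (opp_direction d) (lin_change d f) = f.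
Proof.
case: d => [a|]; last exact: pseries2P.
apply: hform_inj => n; rewrite !hform_lin_change_Some -comp_polyA.
by rewrite comp_polyD comp_polyX comp_polyC polyCN subrK comp_polyXr.
Qed.

Lemma lin_change_inj d f g : lin_change d f = lin_change d g -> f = g.
Proof.
by move/(congr1 (lin_change (opp_direction d))); rewrite !lin_changeK.
Qed.

Lemma mulX f i j : (psX k * f) i j = if i is i'.+1 then f i' j else 0.
Proof.
rewrite coef_mul; case: i => [|i].
  by rewrite big_ord_recl big_ord0 addr0 big1 // => b _; rewrite mul0r.
rewrite big_ord_recl big1 ?add0r => [|b _]; last by rewrite mul0r.
rewrite big_ord_recl [X in _ + X]big1 ?addr0 => [|a _]; last first.
  by apply: big1 => b _; rewrite mul0r.
rewrite big_ord_recl /= mul1r big1 ?addr0 => [|b _]; last by rewrite mul0r.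
by rewrite subn0 subSS subn0.
Qed.

Lemma mulXn e f i j :
  (psX k ^+ e * f) i j = if (e <= i)%N then f (i - e)%N j else 0.
Proof.
elim: e i => [|e IH] i; first by rewrite expr0 mul1r subn0.
by rewrite exprS -mulrA mulX; case: i => [|i]; rewrite ?IH.
Qed.

Lemma mulY f i j : (psY k * f) i j = if j is j'.+1 then f i j' else 0.
Proof.
have YE : psY k = lin_change None (psX k).
  by apply: pseries2P => s t /=; rewrite andbC.
by rewrite YE -{1}(lin_changeK None f) -lin_changeM; apply: mulX.
Qed.

Let pol (p : {poly k}) : R := PSeries2 (fun i j => if i == 0%N then p`_j else 0).

Let polM p q : pol (p * q) = pol p * pol q.
Proof.
apply: pseries2P => i j; rewrite coef_mul big_ord_recl [X in _ + X]big1 ?addr0.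
  rewrite /= subn0; case: eqP => _; first by rewrite coefM.
  by rewrite big1 // => b _; rewrite mulr0.
by move=> a _; apply: big1 => b _; rewrite mul0r.
Qed.

Let polX p n : pol (p ^+ n) = pol p ^+ n.
Proof.
elim: n => [|n IH]; last by rewrite !exprS polM IH.
by apply: pseries2P => i j /=; rewrite coef1; case: i; case: j.
Qed.

Let subst_monomial g a b z i j :
  (psX k ^+ a * (psX k * g) ^+ b * z) i j =
  if (a + b <= i)%N then (g ^+ b * z) (i - (a + b))%N j else 0.
Proof. by rewrite exprMn mulrA -exprD -mulrA mulXn. Qed.

(** Both factors on the right are visibly multiplicative and injective, which is hard to see on the
    truncated sums of [ps_subst]. In either chart the monomial with exponents [s], [b] pulls back to
    x^(s+b) times a polynomial in y, so only the terms with s + b = i reach row [i], and these lie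
    within the truncation. *)
Lemma blowupE d f : blowup d f = monoidal (lin_change d f).
Proof.
case: d => [a|]; apply: pseries2P => i j.
  rewrite monoidalE hform_lin_change_Some.
  transitivity (\sum_(s < (i + j).+1) \sum_(b < (i + j).+1) f s b *
    (psX k ^+ s * (psX k * (psY k + ps_const a)) ^+ b) i j) => //.
  have -> : psY k + ps_const a = pol ('X + a%:P).
    apply: pseries2P => s t; rewrite coef_add /= coefD coefX coefC.
    by case: s => [|s] /=; case: t => [|t]; rewrite ?addr0.
  rewrite /hform poly_def linear_sum coef_sum.
  rewrite [LHS]exchange_big.
  rewrite (big_ord_widen (i + j).+1
    (fun b => ((f (i - b)%N b *: 'X^b) \Po ('X + a%:P))`_j)); last by lia.
  rewrite [RHS]big_mkcond; apply: eq_bigr => b _.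
  under eq_bigr => s _ do rewrite -[_ ^+ b]mulr1 mulrA subst_monomial mulr1 -polX.
  case: ifP => bi; last first.
    by rewrite big1 // => s _; rewrite ifF ?mulr0 //; lia.
  have ib : (i - b < (i + j).+1)%N by lia.
  rewrite (bigD1 (Ordinal ib)) //= big1 ?addr0 => [|s].
    by rewrite subnK // leqnn subnn eqxx comp_polyZ comp_Xn_poly coefZ.
  rewrite -val_eqE /= => sib; case: ifP; rewrite ?mulr0 // => sb.
  by rewrite ifF ?mulr0 //; lia.
transitivity (\sum_(s < (i + j).+1) \sum_(b < (i + j).+1) f s b *
  ((psX k * psY k) ^+ s * psX k ^+ b) i j) => //.
rewrite monoidalE coef_hform.
under eq_bigr => s _ do under eq_bigr => b _ do
  rewrite [_ ^+ s * _]mulrC -[(_ * _) ^+ s]mulr1 mulrA subst_monomial mulr1.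
have YXn s u v : (psY k ^+ s) u v = ((u == 0) && (v == s))%N%:R.
  elim: s u v => [|s IH] u v; first by rewrite expr0 coef_one.
  by rewrite exprS mulY; case: v => [|v]; rewrite ?andbF ?IH.
have ji : (j < (i + j).+1)%N by lia.
rewrite (bigD1 (Ordinal ji)) //= [X in _ + X]big1 ?addr0 => [|s]; last first.
  rewrite -val_eqE /= => sj; apply: big1 => b _; rewrite YXn.
  by rewrite [j == s]eq_sym (negbTE sj) andbF if_same mulr0.
case: (leqP j i) => jle; last first.
  by rewrite big1 // => b _; rewrite ifF ?mulr0 //; lia.
have ib : (i - j < (i + j).+1)%N by lia.
rewrite (bigD1 (Ordinal ib)) //= big1 ?addr0 => [|b].
  by rewrite subnK // leqnn subnn YXn !eqxx mulr1.
rewrite -val_eqE /= => bij; case: ifP; rewrite ?mulr0 // => sb.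
by rewrite YXn (_ : (i - (b + j) == 0)%N = false) ?mulr0 //; lia.
Qed.

Fact blowup_zmod d : zmod_morphism (blowup d : R -> R).
Proof.
move=> f g; rewrite !blowupE; apply/eqP.
by rewrite eq_sym subr_eq -monoidalD -lin_changeD subrK.
Qed.

Fact blowup_monoid d : monoid_morphism (blowup d : R -> R).
Proof.
split=> [|f g]; rewrite !blowupE ?lin_change1 ?monoidal1 //.
by rewrite lin_changeM monoidalM.
Qed.

HB.instance Definition _ d :=
  GRing.isZmodMorphism.Build R R (blowup d) (blowup_zmod d).
HB.instance Definition _ d :=
  GRing.isMonoidMorphism.Build R R (blowup d) (blowup_monoid d).

Lemma blowup_inj d : injective (blowup d : R -> R).
Proof. by move=> f g; rewrite !blowupE => /monoidal_inj/lin_change_inj. Qed.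

End Forms.

(** * Jacobian, orders and strict transforms *)

Section Jacobian.
Variable k : closedFieldType.
Local Notation R := (pseries2 k).
Implicit Types (f g h : R) (d : direction k).

Lemma hform_dy n f : hform n (ps_dy f) = (hform n.+1 f)^`().
Proof.
apply/polyP => j; rewrite coef_deriv !coef_hform /= ltnS.
by case: ifP => _; rewrite ?mul0rn // subSS.
Qed.

(** Euler's relation x f_x + y f_y = (n+1) f for the part of degree [n.+1], dehomogenized at x =
    1. *)
Lemma hform_dx n f :
  hform n (ps_dx f) = n.+1%:R *: hform n.+1 f - 'X * (hform n.+1 f)^`().
Proof.
apply/polyP => j; rewrite coefB coefZ coefXM !coef_hform /= mulr_natl.
case: j => [|j] /=.
  by rewrite !subn0 subr0.
rewrite coef_deriv coef_hform ltnS; case: (ltngtP j n) => [jn|jn|->].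
- by rewrite -subSn // subSS -mulrnBr // ltnW.
- by rewrite !mul0rn subr0.
- by rewrite subrr.
Qed.

(** Chain rule: the factor [psX] is the Jacobian determinant of (u, v) -> (u, uv). *)
Lemma jacobian_monoidal f g :
  jacobian (monoidal f) (monoidal g) = psX k * monoidal (jacobian f g).
Proof.
have dy h : ps_dy (monoidal h) = psX k * monoidal (ps_dy h).
  apply: pseries2P => i j; rewrite mulX /=; case: i => [|i].
    by rewrite coef_hform mul0rn.
  by rewrite hform_dy coef_deriv.
have dx h : ps_dx (monoidal h) = monoidal (ps_dx h) + psY k * monoidal (ps_dy h).
  apply: pseries2P => i j; rewrite coef_add mulY monoidalE hform_dx.
  rewrite coefB coefZ coefXM mulr_natl.
  by case: j => [|j]; rewrite ?subr0 ?addr0 // monoidalE hform_dy subrK.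
have monoidalB u v : monoidal (u - v) = monoidal u - monoidal v.
  by apply/eqP; rewrite eq_sym subr_eq -monoidalD subrK.
rewrite /jacobian monoidalB !monoidalM !dx !dy; ring.
Qed.

(** The sign is the determinant of the linear map: 1 for a shear, -1 for the exchange of
    coordinates. *)
Lemma jacobian_lin_change d f g :
  jacobian (lin_change d f) (lin_change d g) =
  (-1) ^+ (d == None) * lin_change d (jacobian f g).
Proof.
have linB u v : lin_change d (u - v) = lin_change d u - lin_change d v.
  by apply/eqP; rewrite eq_sym subr_eq -lin_changeD subrK.
rewrite /jacobian linB !lin_changeM; case: d {linB} => [a|].
  have dy h : ps_dy (lin_change (Some a) h) = lin_change (Some a) (ps_dy h).
    apply: hform_inj => n; rewrite hform_dy !hform_lin_change_Some hform_dy.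
    by rewrite deriv_comp derivD derivX derivC addr0 mulr1.
  have dx h : ps_dx (lin_change (Some a) h) =
      lin_change (Some a) (ps_dx h) + ps_const a * lin_change (Some a) (ps_dy h).
    apply: hform_inj => n.
    rewrite hformD hform_const_mul hform_dx !hform_lin_change_Some hform_dx hform_dy.
    rewrite deriv_comp derivD derivX derivC addr0 mulr1 comp_polyB comp_polyZ.
    rewrite comp_polyM comp_polyX mulrDl -!mul_polyC; ring.
  rewrite !dx !dy expr0; ring.
have dx h : ps_dx (lin_change None h) = lin_change None (ps_dy h) by [].
have dy h : ps_dy (lin_change None h) = lin_change None (ps_dx h) by [].
rewrite !dx !dy expr1; ring.
Qed.

Lemma jacobian_blowup d f g :
  jacobian (blowup d f) (blowup d g) =
  (-1) ^+ (d == None) * psX k * blowup d (jacobian f g).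
Proof.
rewrite !blowupE jacobian_monoidal jacobian_lin_change monoidalM.
suff -> : monoidal ((-1) ^+ (d == None)) = (-1) ^+ (d == None) :> R.
  by rewrite mulrCA mulrA.
case: eqP => _; rewrite ?expr0 ?monoidal1 // expr1; apply/eqP.
rewrite -subr_eq0 opprK -{2}monoidal1 -monoidalD addNr.
by apply/eqP/pseries2P => i j; rewrite monoidalE coef_hform if_same.
Qed.

End Jacobian.

Section Orders.
Variable k : closedFieldType.
Local Notation R := (pseries2 k).
Implicit Types (f g h : R) (d : direction k).

(** Relational form of the order along x = 0, with no junk value at 0; [ord_alongX] links it to
    [ord_along]. *)
Definition X_ord f e : Prop :=
  (forall i j, (i < e)%N -> f i j = 0) /\ exists j, f e j != 0.

Definition mult_ord f e : Prop :=
  (forall n, (n < e)%N -> hform n f = 0) /\ hform e f != 0.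

Lemma poly_neq0P (p : {poly k}) : p != 0 <-> exists j, p`_j != 0.
Proof.
split=> [p0|[j]]; last by apply: contraNneq => ->; rewrite coef0.
by exists (size p).-1; rewrite -[_`_ _]/(lead_coef p) lead_coef_eq0.
Qed.

Lemma X_ord_monoidal f e : X_ord (monoidal f) e <-> mult_ord f e.
Proof.
split=> -[lo nz]; split.
- by move=> n ne; apply/polyP => j; rewrite coef0; apply: lo.
- exact/poly_neq0P.
- by move=> i j ie; rewrite monoidalE lo // coef0.
- exact/poly_neq0P.
Qed.

Lemma hform_lin_change_eq0 d n f : (hform n (lin_change d f) == 0) = (hform n f == 0).
Proof.
suff imp d' g : hform n g = 0 -> hform n (lin_change d' g) = 0.
  by apply/eqP/eqP => [|/imp //]; move/(imp (opp_direction d)); rewrite lin_changeK.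
case: d' => [a|] g0; first by rewrite hform_lin_change_Some g0 comp_poly0.
apply/polyP => j; case: (leqP j n) => jn; last by rewrite coef_hform leqNgt jn coef0.
by rewrite hform_lin_change_None // g0 !coef0.
Qed.

Lemma mult_ord_lin_change d f e : mult_ord (lin_change d f) e <-> mult_ord f e.
Proof.
rewrite /mult_ord hform_lin_change_eq0; split=> -[lo nz]; split=> // n ne; apply/eqP.
- by rewrite -(hform_lin_change_eq0 d) lo.
- by rewrite hform_lin_change_eq0 lo.
Qed.

Lemma X_ord_blowup d f e : X_ord (blowup d f) e <-> mult_ord f e.
Proof. by rewrite blowupE X_ord_monoidal mult_ord_lin_change. Qed.

Lemma X_ordP f e :
  X_ord f e <-> exists h, f = psX k ^+ e * h /\ exists j, h 0%N j != 0.
Proof.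
split=> [[lo [j nz]]|[h [-> [j nz]]]].
  exists (PSeries2 (fun i j => f (i + e)%N j)); split; last by exists j.
  apply: pseries2P => i' j'; rewrite mulXn; case: leqP => [/subnK /= -> //|ie].
  exact: lo.
split=> [i j' ie|]; first by rewrite mulXn leqNgt ie.
by exists j; rewrite mulXn leqnn subnn.
Qed.

Lemma X_ord_inj f e e' : X_ord f e -> X_ord f e' -> e = e'.
Proof.
move=> [lo [j nz]] [lo' [j' nz']]; case: (ltngtP e e') => // lt.
- by rewrite lo' ?eqxx in nz.
- by rewrite lo ?eqxx in nz'.
Qed.

Lemma mult_ord_inj f e e' : mult_ord f e -> mult_ord f e' -> e = e'.
Proof. by rewrite -!X_ord_monoidal; apply: X_ord_inj. Qed.

Lemma X_ordM f g a b : X_ord f a -> X_ord g b -> X_ord (f * g) (a + b).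
Proof.
move=> /X_ordP[f' [-> /seq_ord_ex[m [fm flo]]]].
move=> /X_ordP[g' [-> /seq_ord_ex[n [gn glo]]]].
apply/X_ordP; exists (f' * g'); split; first by rewrite exprD; ring.
have mn : (m < (m + n).+1)%N by rewrite ltnS leq_addr.
exists (m + n)%N; rewrite coef_mul0 (bigD1 (Ordinal mn)) //= addKn.
rewrite big1 ?addr0 ?mulf_neq0 // => b'; rewrite -val_eqE /= => b'm.
case: (ltnP b' m) => [/flo ->|mb']; first by rewrite mul0r.
by rewrite glo ?mulr0 //; have := ltn_ord b'; lia.
Qed.

Lemma mult_ordM f g a b : mult_ord f a -> mult_ord g b -> mult_ord (f * g) (a + b).
Proof. by rewrite -!X_ord_monoidal monoidalM; apply: X_ordM. Qed.

Lemma mult_ord_ex f : f != 0 -> exists e, mult_ord f e.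
Proof.
move=> f0.
have ex : exists n, hform n f != 0.
  apply: contrapT => none; move/eqP: f0; apply; apply: hform_inj => n.
  have [->|nz] := eqVneq (hform n f) 0; last by case: none; exists n.
  by apply/polyP => j; rewrite coef_hform if_same coef0.
exists (ex_minn ex); case: ex_minnP => m nz min; split=> // m' lt.
by apply/eqP; apply: contraTT lt => /min; rewrite -leqNgt.
Qed.

Lemma mult_ord_neq0 f e : mult_ord f e -> f != 0.
Proof.
case=> _; apply: contraNneq => ->; apply/eqP/polyP => j.
by rewrite coef_hform if_same coef0.
Qed.

Fact ps_integral : GRing.integral_domain_axiom R.
Proof.
move=> f g fg; have [//|f0] := eqVneq f 0; have [//|g0] := eqVneq g 0.
have [[a fa] [b gb]] := (mult_ord_ex f0, mult_ord_ex g0).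
by have /eqP := mult_ord_neq0 (mult_ordM fa gb).
Qed.

HB.instance Definition _ :=
  GRing.ComUnitRing_isIntegral.Build (pseries2 k) ps_integral.

Lemma X_neq0 : psX k != 0.
Proof.
apply/eqP => /(congr1 (fun f : R => f 1%N 0%N)) /eqP.
by rewrite /= oner_eq0.
Qed.

Lemma mult_ord_unit f : f \is a GRing.unit <-> mult_ord f 0.
Proof.
rewrite ps_unitE; have -> : f 0%N 0%N = (hform 0 f)`_0 by rewrite coef_hform.
split=> [nz|[_ nz]]; first by split=> //; apply/poly_neq0P; exists 0%N.
apply: contra nz => /eqP z; apply/eqP/polyP => -[|j]; rewrite coef0 // coef_hform //.
Qed.

Lemma mult_ordX f e n : mult_ord f e -> mult_ord (f ^+ n) (n * e).
Proof.
move=> fe; elim: n => [|n IH]; first by rewrite mul0n; apply/mult_ord_unit/unitr1.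
by rewrite exprS mulSn; apply: mult_ordM.
Qed.

Lemma mult_ord_prod (I : finType) (F : I -> R) (e : I -> nat) :
  (forall i, mult_ord (F i) (e i)) -> mult_ord (\prod_i F i) (\sum_i e i).
Proof.
move=> Fe; apply: (big_rec2 (fun f e => mult_ord f e)) => [|i x y _].
  exact/mult_ord_unit/unitr1.
exact: mult_ordM.
Qed.

Lemma mult_ord_associated f g e : associated f g -> mult_ord f e -> mult_ord g e.
Proof.
move=> [w /mult_ord_unit w0 ->] fe; rewrite -[e]add0n; exact: mult_ordM.
Qed.

Lemma ord_alongX f e : X_ord f e -> ord_along (psX k) f = e.
Proof.
move=> /X_ordP[h [-> [j nz]]]; apply: xget_unique => /=.
  split; first by exists h.
  case=> g; rewrite exprSr -mulrA => /(mulfI (expf_neq0 e X_neq0)) hE.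
  by rewrite hE mulX eqxx in nz.
move=> n [[g gE] ngt]; case: (ltngtP n e) => // ne.
  case: ngt; exists (psX k ^+ (e - n.+1) * h).
  by rewrite mulrA -exprD subnKC.
move: gE; rewrite -(subnKC ne) addSnnS exprD -mulrA.
move=> /(mulfI (expf_neq0 e X_neq0)) hE.
by rewrite hE mulXn /= eqxx in nz.
Qed.

Lemma strict1P d f e : mult_ord f e ->
  blowup d f = psX k ^+ e * strict1 d f /\ exists j, strict1 d f 0%N j != 0.
Proof.
move=> fe; have fe' := (X_ord_blowup d f e).2 fe.
have [h [hE [j nz]]] := (X_ordP _ _).1 fe'.
suff -> : strict1 d f = h by split=> //; exists j.
rewrite /strict1 (ord_alongX fe'); apply: xget_unique => //= h'.
by rewrite hE => /(mulfI (expf_neq0 e X_neq0)) ->.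
Qed.

Lemma strict1_eq d f e h : mult_ord f e ->
  blowup d f = psX k ^+ e * h -> strict1 d f = h.
Proof.
move=> fe; have [-> _] := strict1P d fe.
by move=> /(mulfI (expf_neq0 e X_neq0)).
Qed.

(** The strict transform meets the exceptional curve in the zeros of the initial form. Every later
    statement on tangent directions and on contact with the exceptional curve rests on this. *)
Lemma strict1_coef0 d f e j : mult_ord f e ->
  strict1 d f 0%N j = (hform e (lin_change d f))`_j.
Proof.
move=> fe; have [E _] := strict1P d fe.
by rewrite -monoidalE -blowupE E mulXn leqnn subnn.
Qed.

Lemma strict1_neq0 d f : f != 0 -> strict1 d f != 0.
Proof.
move=> /mult_ord_ex[e fe]; have [_ [j]] := strict1P d fe.
by apply: contraNneq => ->.
Qed.

Lemma strict1M d f g : f != 0 -> g != 0 ->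
  strict1 d (f * g) = strict1 d f * strict1 d g.
Proof.
move=> /mult_ord_ex[a fa] /mult_ord_ex[b gb].
apply: (strict1_eq (mult_ordM fa gb)); rewrite rmorphM exprD /=.
by rewrite (strict1P d fa).1 (strict1P d gb).1; ring.
Qed.

Lemma strict1_unit d f : f \is a GRing.unit -> strict1 d f \is a GRing.unit.
Proof.
move=> fU; have f0 := (mult_ord_unit f).1 fU.
by have := rmorph_unit (blowup d) fU; rewrite /= (strict1P d f0).1 mul1r.
Qed.

Lemma strict_neq0 p f : f != 0 -> strict p f != 0.
Proof. by elim: p f => //= d p IH f /(strict1_neq0 d)/IH. Qed.

Lemma strictM p f g : f != 0 -> g != 0 ->
  strict p (f * g) = strict p f * strict p g.
Proof.
elim: p f g => //= d p IH f g f0 g0.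
by rewrite strict1M // IH // strict1_neq0.
Qed.

Lemma strict_unit p f : f \is a GRing.unit -> strict p f \is a GRing.unit.
Proof. by elim: p f => //= d p IH f /(strict1_unit d)/IH. Qed.

Lemma strict_cat p q f : strict (p ++ q) f = strict q (strict p f).
Proof. exact: foldl_cat. Qed.

Lemma strict_rcons p d f : strict (rcons p d) f = strict1 d (strict p f).
Proof. exact: foldl_rcons. Qed.

Lemma pullback_rcons p d f : pullback (rcons p d) f = blowup d (pullback p f).
Proof. exact: foldl_rcons. Qed.

Lemma pullback1 p : pullback p (1 : R) = 1.
Proof. by elim: p => //= d p IH; rewrite rmorph1. Qed.

Lemma blowup_neq0 d f : f != 0 -> blowup d f != 0.
Proof.
apply: contraNneq => bf0; apply/eqP/(@blowup_inj _ d).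
by rewrite bf0 (rmorph0 (blowup d)).
Qed.

Lemma pullback_neq0 p f : f != 0 -> pullback p f != 0.
Proof. by elim: p f => //= d p IH f /(blowup_neq0 d)/IH. Qed.

Lemma through_strict_prefix p q f :
  prefix p q -> through (strict q f) -> through (strict p f).
Proof.
move=> /prefixP[s ->]; rewrite strict_cat.
by apply: contra; apply: strict_unit.
Qed.

Lemma mult_excP p f : f != 0 -> mult_ord (pullback p f) (mult_exc p f).
Proof.
move=> f0; have [e fe] := mult_ord_ex (pullback_neq0 p f0).
by rewrite /mult_exc pullback_rcons (ord_alongX ((X_ord_blowup _ _ _).2 fe)).
Qed.

Lemma mult_exc_eq p f e : mult_ord (pullback p f) e -> mult_exc p f = e.
Proof.
by move=> fe; rewrite /mult_exc pullback_rcons (ord_alongX ((X_ord_blowup _ _ _).2 fe)).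
Qed.

Definition canonical_jacobian p : R :=
  jacobian (pullback p (psX k)) (pullback p (psY k)).

Lemma canonical_jacobian_nil : canonical_jacobian [::] = 1.
Proof.
rewrite /canonical_jacobian /jacobian /=.
have -> : ps_dx (psX k) = 1.
  by apply: pseries2P => -[|i] [|j]; rewrite /= ?mul0rn.
have -> : ps_dy (psX k) = 0.
  by apply: pseries2P => i j; rewrite /= andbF mul0rn.
have -> : ps_dy (psY k) = 1.
  by apply: pseries2P => -[|i] [|j] //=; rewrite mul0rn.
by rewrite mulr1 mul0r subr0.
Qed.

Lemma canonical_jacobian_rcons p d :
  canonical_jacobian (rcons p d) =
  (-1) ^+ (d == None) * psX k * blowup d (canonical_jacobian p).
Proof. by rewrite /canonical_jacobian !pullback_rcons jacobian_blowup. Qed.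

(** The extra 1 is the Jacobian of the last blowing-up itself. *)
Lemma canon_exc_eq p e : mult_ord (canonical_jacobian p) e -> canon_exc p = e.+1.
Proof.
move=> /(X_ord_blowup (Some 0)) je; rewrite /canon_exc -/(canonical_jacobian _).
rewrite canonical_jacobian_rcons mul1r; apply: ord_alongX; rewrite -add1n.
apply: X_ordM => //; split=> [i j i1|]; last by exists 0%N; rewrite /= oner_eq0.
by case: i i1.
Qed.

End Orders.

(** * Irreducible germs through infinitely near points *)

Section Branches.
Variable k : closedFieldType.
Local Notation R := (pseries2 k).
Implicit Types (f g h : R) (d : direction k) (p q : inpoint k).

Lemma coef_Yn n i j : (psY k ^+ n) i j = ((i == 0) && (j == n))%N%:R.
Proof.
elim: n i j => [|n IH] i j; first by rewrite expr0 coef_one.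
by rewrite exprS mulY; case: j => [|j]; rewrite ?andbF ?IH.
Qed.

(* G is replaced by a Weierstrass polynomial in v of degree a, which is the
   strict transform of a polynomial A of degree a in y; the remainder of h
   modulo A vanishes because so does its pull-back, by uniqueness of
   Weierstrass division by G. *)
Lemma monoidal_descent h e h1 G :
  irreducible_elt h -> mult_ord h e -> monoidal h = psX k ^+ e * h1 ->
  divides G h1 -> G \isn't a GRing.unit ->
  associated G h1 /\ exists2 c, c != 0 & hform e h = c *: 'X^e.
Proof.
move=> [h0 hU hirr] he hE [c cE] /nonunitE G00.
have h1_0 : exists j, h1 0%N j != 0.
  have /X_ord_monoidal[_ [j nz]] := he; exists j.
  by move: nz; rewrite hE mulXn leqnn subnn.
have /seq_ord_ex[a Ga] : exists j, G 0%N j != 0.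
  apply: contrapT => G0; have [j /eqP] := h1_0; apply.
  rewrite cE coef_mul0 big1 // => b _.
  have [->|nz] := eqVneq (G 0%N b) 0; first by rewrite mul0r.
  by case: G0; exists b.
have a_gt0 : (0 < a)%N.
  by case: a Ga => // -[]; rewrite G00 eqxx.
have [Q [r [QE rlo]]] := weierstrass_division Ga (psY k ^+ a).
have QG i j : (Q * G) i j = ((i == 0) && (j == a))%N%:R - r i j.
  by rewrite -coef_Yn QE coef_add addrK.
have QG0 j : (j < a)%N -> (Q * G) 0%N j = 0.
  move=> ja; rewrite coef_mul0 big1 // => b _.
  by case: Ga => _ ->; rewrite ?mulr0 //; lia.
have QGa : (Q * G) 0%N a = 1 by rewrite QG !eqxx rlo ?subr0.
have QGrow j : (Q * G) 0%N j = (j == a)%:R.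
  case: (ltnP j a) => [ja|aj]; first by rewrite QG0 // ltn_eqF.
  by rewrite QG rlo // subr0.
(* On u = 0 the product [Q * G] is v^a and [G] already has order [a], so [Q] is a unit. *)
have Q00 : Q 0%N 0%N != 0.
  apply: contra_eq_neq QGa => Q0; rewrite coef_mul0 big_ord_recl Q0 mul0r add0r.
  rewrite big1 1?eq_sym ?oner_eq0 // => b _.
  by case: Ga => _ ->; rewrite ?mulr0 // lift0; lia.
(* [Q * G] is v^a minus the sum of the r_j(u) v^j over j < a. Since x^(a-j) y^j pulls back to u^a
   v^j, the shift of the x-exponent by [a - j] yields a series whose pull-back is u^a times
   [Q * G]. *)
pose A : R := PSeries2 (fun i j => if (j < a)%N
  then if (a - j <= i)%N then - r (i - (a - j))%N j else 0
  else ((i == 0) && (j == a))%N%:R).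
have AE : monoidal A = psX k ^+ a * (Q * G).
  apply: pseries2P => i j; rewrite monoidalE coef_hform mulXn QG /=.
  case: (ltnP j a) => ja.
    rewrite (ltn_eqF ja) andbF sub0r.
    case: (leqP a i) => ai; last by case: ifP => // ji; rewrite ifF //; lia.
    by rewrite !ifT; [congr (- r _ _) | ..]; lia.
  rewrite rlo // subr0; case: (ltngtP j a) ja => // [aj|->] _.
    by rewrite !andbF !if_same.
  by rewrite !andbT.
have AeX n : hform n A = if (n <= a)%N then (n == a)%:R *: 'X^a else hform n A.
  case: leqP => // na; apply/polyP => j; rewrite -monoidalE AE mulXn coefZ coefXn.
  case: (ltngtP n a) na => [na|//|->] _; first by rewrite mul0r.
  by rewrite subnn QGrow mul1r.
have Aa : mult_ord A a.
  split=> [n na|]; rewrite AeX ?leqnn ?eqxx ?(ltnW na) ?(ltn_eqF na).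
    by rewrite scale0r.
  by rewrite scale1r -size_poly_eq0 size_polyXn.
have Aord : seq_ord (A 0%N) a.
  split=> [|j ja] /=; first by rewrite ltnn eqxx oner_eq0.
  by rewrite ja ifF //; lia.
have [S [r' [hSA r'lo]]] := weierstrass_division Aord h.
have r'0 : r' = 0.
  have r'E : monoidal r' = (psX k ^+ e * c - monoidal S * psX k ^+ a * Q) * G.
    have -> : r' = h + (-1) * S * A by rewrite {1}hSA; ring.
    have mN1 : monoidal (-1) = -1 :> R.
      apply/eqP; rewrite -subr_eq0 opprK -{2}(monoidal1 k) -monoidalD addNr.
      by apply/eqP/pseries2P => i j; rewrite monoidalE coef_hform if_same.
    by rewrite monoidalD !monoidalM mN1 hE cE AE; ring.
  have T0 : psX k ^+ e * c - monoidal S * psX k ^+ a * Q = 0.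
    apply: (weierstrass_unique Ga) => i j aj; rewrite -r'E monoidalE coef_hform.
    by rewrite r'lo ?if_same.
  apply: monoidal_inj; rewrite r'E T0 mul0r.
  by apply: pseries2P => i j; rewrite monoidalE coef_hform if_same.
rewrite r'0 addr0 in hSA.
have AU : A \isn't a GRing.unit by apply/nonunitE; case: Aord => _ ->.
have SU : S \is a GRing.unit.
  by have [//|AU'] := hirr _ _ hSA; rewrite AU' in AU.
(* [S] is a unit, so [h] has the multiplicity of [A]; this equality lets the powers of [psX] cancel
   upstairs. *)
have ea : e = a.
  apply: mult_ord_inj he _; rewrite hSA -[a]add0n.
  by apply: mult_ordM => //; apply/mult_ord_unit.
subst a; split.
  exists (monoidal S * Q).
    by rewrite unitrM !ps_unitE Q00 andbT /= coef_hform -ps_unitE.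
  apply: (mulfI (expf_neq0 e (X_neq0 k))).
  by rewrite -hE hSA monoidalM AE; ring.
exists (S 0%N 0%N); first by rewrite -ps_unitE.
rewrite hSA hformM big_ord_recl big1 ?addr0 => [|s _]; last first.
  by case: Aa => lo _; rewrite lo ?mulr0 // lift0; lia.
rewrite subn0 AeX leqnn eqxx scale1r -mul_polyC; congr (_ * _).
by apply/polyP => -[|j]; rewrite coef_hform coefC.
Qed.

Lemma irreducible_lin_change d h :
  irreducible_elt h -> irreducible_elt (lin_change d h).
Proof.
have linU d' f : (lin_change d' f \is a GRing.unit) = (f \is a GRing.unit).
  by apply/idP/idP => /mult_ord_unit /mult_ord_lin_change /mult_ord_unit.
move=> [h0 hU hirr]; split; rewrite ?linU //.
  have [e he] := mult_ord_ex h0; apply: (@mult_ord_neq0 _ _ e).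
  exact/mult_ord_lin_change.
move=> b c E; rewrite -(linU (opp_direction d) b) -(linU (opp_direction d) c).
by apply: hirr; rewrite -lin_changeM -E lin_changeK.
Qed.

(** [monoidal_descent] serves twice. With [G] the whole strict transform it gives the initial form;
    with [G] a non-unit factor [b] it makes [b] associated to the whole, so that the cofactor is a
    unit. *)
Lemma branch_descent d h e :
  irreducible_elt h -> mult_ord h e -> through (strict1 d h) ->
  irreducible_elt (strict1 d h) /\
  exists2 c, c != 0 & hform e (lin_change d h) = c *: 'X^e.
Proof.
move=> hirr he hd; have [h0 _ _] := hirr.
have lirr := irreducible_lin_change d hirr.
have le := (mult_ord_lin_change d h e).2 he.
have [E _] := strict1P d he; rewrite blowupE in E.
split; last first.
  suff [_ //] : associated (strict1 d h) (strict1 d h) /\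
    exists2 c, c != 0 & hform e (lin_change d h) = c *: 'X^e.
  by apply: monoidal_descent lirr le E _ hd; exists 1; rewrite mulr1.
split=> //; first exact: strict1_neq0.
move=> b c bc; have [bU|bU] := boolP (b \is a GRing.unit); first by left.
right; have b0 : b != 0.
  by apply: contraNneq (strict1_neq0 d h0) => b0; rewrite bc b0 mul0r.
have [[w wU wE] _] :
    associated b (strict1 d h) /\
    exists2 c, c != 0 & hform e (lin_change d h) = c *: 'X^e.
  by apply: monoidal_descent lirr le E _ bU; exists c.
suff -> : c = w by [].
by apply: (mulfI b0); rewrite -bc wE mulrC.
Qed.

Lemma through_strict1_Some a h e : mult_ord h e ->
  through (strict1 (Some a) h) <-> (hform e h).[a] = 0.
Proof.
move=> he; rewrite /through nonunitE (strict1_coef0 _ _ he).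
rewrite hform_lin_change_Some -horner_coef0 horner_comp !hornerE.
by [].
Qed.

Lemma through_strict1_None h e : mult_ord h e ->
  through (strict1 None h) <-> (hform e h)`_e = 0.
Proof.
move=> he; rewrite /through nonunitE (strict1_coef0 _ _ he).
by rewrite hform_lin_change_None // subn0.
Qed.

(** Over an algebraically closed field the initial form has a zero on the projective line: at
    infinity, direction [None], if its coefficient of index [e] vanishes, and otherwise at a root of
    a polynomial of degree [e]. *)
Lemma direction_ex h : h != 0 -> through h -> exists d, through (strict1 d h).
Proof.
move=> /mult_ord_ex[e he] hU.
have [z|nz] := eqVneq ((hform e h)`_e) 0.
  by exists None; apply/(through_strict1_None he).
have e_gt0 : e != 0%N by apply: contraNneq hU => e0; apply/mult_ord_unit; rewrite -e0.
have sz : size (hform e h) != 1%N.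
  rewrite neq_ltn; apply/orP; right; apply: leq_trans (_ : (e < _)%N); first by lia.
  by rewrite ltnNge; apply: contra nz => /(nth_default 0) ->.
have [a /rootP az] := closed_rootP _ sz.
by exists (Some a); apply/(through_strict1_Some a he).
Qed.

(** The initial form is a power of one linear form, up to a constant, and so has a single zero on
    the projective line. *)
Lemma branch_direction_unique d d' h : irreducible_elt h ->
  through (strict1 d h) -> through (strict1 d' h) -> d = d'.
Proof.
move=> hirr; have [/mult_ord_ex[e he] _ _] := hirr.
have Some_form a : through (strict1 (Some a) h) ->
    exists2 c, c != 0 & hform e h = c *: ('X - a%:P) ^+ e.
  move=> ha; have [_ [c c0 cE]] := branch_descent hirr he ha; exists c => //.
  rewrite -(lin_changeK (Some a) h) hform_lin_change_Some cE.
  by rewrite comp_polyZ comp_Xn_poly polyCN.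
have noNone a : through (strict1 (Some a) h) -> ~ through (strict1 None h).
  move=> /Some_form[c c0 E] /(through_strict1_None he); rewrite E coefZ.
  have := monic_exp e (monicXsubC a); rewrite monicE lead_coefE size_exp_XsubC /=.
  by move=> /eqP ->; rewrite mulr1; apply/eqP.
case: d d' => [a|] [a'|] hd hd'.
- have [c c0 E] := Some_form _ hd.
  move: hd' => /(through_strict1_Some _ he); rewrite E !hornerE => /eqP.
  by rewrite mulf_eq0 (negbTE c0) expf_eq0 subr_eq0 => /andP[_ /eqP ->].
- by case: (noNone _ hd hd').
- by case: (noNone _ hd' hd).
- by [].
Qed.

Lemma irreducible_strict p h :
  irreducible_elt h -> through (strict p h) -> irreducible_elt (strict p h).
Proof.
elim: p h => //= d p IH h hirr hp; apply: IH => //.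
have [/mult_ord_ex[e he] _ _] := hirr.
apply: (branch_descent hirr he _).1.
exact: (through_strict_prefix (prefix0s p) hp).
Qed.

Lemma branch_points_comparable p q h : irreducible_elt h ->
  through (strict p h) -> through (strict q h) -> prefix p q \/ prefix q p.
Proof.
elim: p q h => [|d p IH] [|d' q] h hirr hp hq; [by left|by left|by right|].
have hd : through (strict1 d h) by exact: (through_strict_prefix (prefix0s p) hp).
have hd' : through (strict1 d' h) by exact: (through_strict_prefix (prefix0s q) hq).
have dd' := branch_direction_unique hirr hd hd'; subst d'.
have [/mult_ord_ex[e he] _ _] := hirr.
have := IH q _ (branch_descent hirr he hd).1 hp hq.
by rewrite !prefix_cons !eqxx.
Qed.

Lemma seq_ord_shift (s t : nat -> k) e m :
  (forall i, s i = if (e <= i)%N then t (i - e)%N else 0) ->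
  seq_ord s m <-> exists2 m', m = (e + m')%N & seq_ord t m'.
Proof.
move=> st; split=> [[nz lo]|[m' -> [nz lo]]].
  have em : (e <= m)%N by move: nz; rewrite st; case: ifP; rewrite ?eqxx.
  exists (m - e)%N; first by rewrite subnKC.
  split=> [|i im]; first by move: nz; rewrite st em.
  have := lo (e + i)%N; rewrite st leq_addr addKn; apply; lia.
split=> [|i im]; first by rewrite st leq_addr addKn.
by rewrite st; case: ifP => // ei; apply: lo; lia.
Qed.

(** The contact of the strict transform with the new exceptional curve u = 0 is the multiplicity [e]
    at the point below. This is how a multiplicity is recovered from data at the next point. *)
Lemma Y_ord_branch d h e : irreducible_elt h -> mult_ord h e ->
  through (strict1 d h) -> seq_ord (strict1 d h 0%N) e.
Proof.
move=> hirr he hd; have [_ [c c0 E]] := branch_descent hirr he hd.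
split=> [|j je]; rewrite (strict1_coef0 _ _ he) E coefZ coefXn ?eqxx ?mulr1 //.
by rewrite ltn_eqF ?mulr0.
Qed.

(** [None] is the direction of the axis x = 0: a branch not tangent to the axis meets it with
    multiplicity [e]. *)
Lemma Y_ord_not_None d h e : irreducible_elt h -> mult_ord h e ->
  through (strict1 d h) -> d <> None -> seq_ord (h 0%N) e.
Proof.
move=> hirr he hd dN; split=> [|j je]; rewrite coef_of_hform add0n; last first.
  by case: he => lo _; rewrite lo // coef0.
apply/eqP => /(through_strict1_None he) hN.
by apply: dN; apply: branch_direction_unique hirr hd hN.
Qed.

Lemma X_ord_not_Some0 d h e : irreducible_elt h -> mult_ord h e ->
  through (strict1 d h) -> d <> Some 0 -> seq_ord (h^~ 0%N) e.
Proof.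
move=> hirr he hd dN; split=> [|j je]; rewrite coef_of_hform addn0; last first.
  by case: he => lo _; rewrite lo // coef0.
rewrite -horner_coef0; apply/eqP => /(through_strict1_Some _ he) h0.
by apply: dN; apply: branch_direction_unique hirr hd h0.
Qed.

(** Noether's formula for the germ and the axis x = 0: the intersection number drops by [e] when
    both are replaced by their strict transforms, and that of the axis is v = 0 in the direction
    [None]. *)
Lemma Y_ord_None h e m : mult_ord h e ->
  seq_ord (h 0%N) m <->
  exists2 m', m = (e + m')%N & seq_ord ((strict1 None h)^~ 0%N) m'.
Proof.
move=> he; apply: seq_ord_shift => i; rewrite -mulXn -(strict1P None he).1.
by rewrite blowupE monoidalE coef_hform subn0.
Qed.

Lemma X_ord_Some0 h e m : mult_ord h e ->
  seq_ord (h^~ 0%N) m <->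
  exists2 m', m = (e + m')%N & seq_ord ((strict1 (Some 0) h)^~ 0%N) m'.
Proof.
move=> he; apply: seq_ord_shift => i; rewrite -mulXn -(strict1P (Some 0) he).1.
rewrite blowupE monoidalE hform_lin_change_Some addr0 comp_polyXr.
by rewrite coef_hform subn0.
Qed.

End Branches.

(** * Exceptional curves *)

Section Associated.
Variable A : comUnitRingType.
Implicit Types a b c : A.

Lemma associated_refl a : associated a a.
Proof. by exists 1; rewrite ?unitr1 ?mul1r. Qed.

Lemma associated_trans b a c : associated a b -> associated b c -> associated a c.
Proof.
by move=> [w wU ->] [v vU ->]; exists (v * w); rewrite ?unitrM ?vU // mulrA.
Qed.

Lemma associatedM a b a' b' :
  associated a b -> associated a' b' -> associated (a * a') (b * b').
Proof.
move=> [w wU ->] [v vU ->]; exists (w * v); first by rewrite unitrM wU.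
by rewrite mulrACA.
Qed.

Lemma associated1 a : associated 1 a <-> a \is a GRing.unit.
Proof. by split=> [[w wU ->]|aU]; [rewrite mulr1|exists a; rewrite ?mulr1]. Qed.

Lemma associatedX n a b : associated a b -> associated (a ^+ n) (b ^+ n).
Proof.
by move=> [w wU ->]; exists (w ^+ n); rewrite ?unitrX // exprMn.
Qed.

Lemma associated_prod (I : finType) (F G : I -> A) :
  (forall i, associated (F i) (G i)) -> associated (\prod_i F i) (\prod_i G i).
Proof.
move=> FG; apply: (big_rec2 (fun a b => associated a b)) => [|i x y _].
  exact: associated_refl.
exact: associatedM.
Qed.

End Associated.

Section ExceptionalCurves.
Variable k : closedFieldType.
Local Notation R := (pseries2 k).
Implicit Types (f g h : R) (d : direction k) (p q : inpoint k).

Lemma hform_X n : hform n (psX k) = (n == 1)%:R.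
Proof.
apply/polyP => j; rewrite coef_hform -polyC_natr coefC /=.
by case: j => [|j]; rewrite ?andbF ?if_same // subn0 andbT; case: n => [|[|n]].
Qed.

Lemma hform_Y n : hform n (psY k) = (n == 1)%:R *: 'X.
Proof.
apply/polyP => j; rewrite coef_hform coefZ coefX /=.
case: j => [|[|j]]; rewrite ?andbF ?if_same ?mulr0 //.
by case: n => [|[|n]] //=; rewrite ?mul0r ?mul1r.
Qed.

Lemma blowup_X_Some a : blowup (Some a) (psX k) = psX k.
Proof.
rewrite blowupE; apply: pseries2P => i j.
rewrite monoidalE hform_lin_change_Some hform_X -polyC_natr comp_polyC coefC /=.
by case: j => [|j]; rewrite ?andbF ?andbT.
Qed.

Lemma blowup_X_None : blowup None (psX k) = psX k * psY k.
Proof.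
rewrite blowupE; apply: pseries2P => i j; rewrite monoidalE coef_hform mulX /=.
by case: i j => [|[|i]] [|[|j]] //=; rewrite ?andbF ?if_same.
Qed.

Lemma blowup_Y_Some a : blowup (Some a) (psY k) = psX k * (psY k + ps_const a).
Proof.
rewrite blowupE; apply: pseries2P => i j.
rewrite monoidalE hform_lin_change_Some hform_Y comp_polyZ comp_polyX coefZ.
rewrite coefD coefX coefC mulX.
by case: i j => [|[|i]] [|[|j]]; rewrite /= ?(mul0r, mul1r, addr0, add0r, mulr1n).
Qed.

Lemma blowup_Y_None : blowup None (psY k) = psX k.
Proof.
rewrite blowupE; apply: pseries2P => i j; rewrite monoidalE coef_hform /=.
by case: i j => [|[|i]] [|[|j]] //=; rewrite ?andbF ?if_same.
Qed.

Lemma mult_ord_X : mult_ord (psX k) 1.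
Proof.
split=> [n|]; rewrite hform_X ?oner_neq0 // => n1.
by case: n n1.
Qed.

Lemma mult_ord_Y : mult_ord (psY k) 1.
Proof.
split=> [n|]; rewrite hform_Y ?scale1r ?polyX_eq0 // => n1.
by case: n n1 => // _; rewrite scale0r.
Qed.

Lemma strict1_X_None : strict1 None (psX k) = psY k.
Proof. by apply: (strict1_eq mult_ord_X); rewrite blowup_X_None. Qed.

Lemma strict1_X_Some a : strict1 (Some a) (psX k) = 1.
Proof. by apply: (strict1_eq mult_ord_X); rewrite blowup_X_Some mulr1. Qed.

Lemma strict1_Y_None : strict1 None (psY k) = 1.
Proof. by apply: (strict1_eq mult_ord_Y); rewrite blowup_Y_None mulr1. Qed.

Lemma strict1_Y_Some a : strict1 (Some a) (psY k) = psY k + ps_const a.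
Proof. by apply: (strict1_eq mult_ord_Y); rewrite blowup_Y_Some. Qed.

Lemma Y_shift_unit a : (psY k + ps_const a \is a GRing.unit) = (a != 0).
Proof. by rewrite ps_unitE coef_add /= add0r mulr1n. Qed.

Lemma Y_shift0 : psY k + ps_const 0 = psY k.
Proof. by apply: pseries2P => i j; rewrite coef_add /= mul0rn addr0. Qed.

Lemma X_neq_Y : psX k <> psY k.
Proof. by move/(congr1 (fun f : R => f 1%N 0%N)) => /eqP; rewrite /= oner_eq0. Qed.

Lemma through_X : through (psX k). Proof. exact/nonunitE. Qed.
Lemma through_Y : through (psY k). Proof. exact/nonunitE. Qed.
Lemma not_through1 : ~ through (1 : R). Proof. by rewrite /through unitr1. Qed.

Lemma prefix_rconsE p q d : prefix p (rcons q d) = prefix p q || (p == rcons q d).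
Proof.
apply/idP/orP => [/prefixP[s]|[pq|/eqP ->]]; last exact: prefix_refl.
  case/lastP: s => [|s d' E]; first by rewrite cats0 => <-; right.
  left; apply/prefixP; exists s; move: E; rewrite -rcons_cat.
  by case/rcons_inj.
exact: prefix_trans pq (prefix_rcons q d).
Qed.

Lemma prefix_size_eq p q : prefix p q -> (size q <= size p)%N -> p = q.
Proof. by rewrite prefixE => /eqP {2}<- /take_oversize ->. Qed.

Lemma prefix_neq_size p q : prefix p q -> p != q -> (size p < size q)%N.
Proof. by move=> pq; apply: contraNT; rewrite -leqNgt => /(prefix_size_eq pq) ->. Qed.

Lemma strict1_1 d : strict1 d (1 : R) = 1.
Proof.
by apply: (@strict1_eq _ _ _ 0); rewrite ?rmorph1 ?mulr1 //; apply/mult_ord_unit/unitr1.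
Qed.

Lemma exc_rcons p q d :
  exc p (rcons q d) = if p == q then psX k else strict1 d (exc p q).
Proof.
rewrite /exc prefix_rconsE; case: (eqVneq p q) => [->|pq].
  rewrite prefix_refl /= ifT; first by rewrite drop_oversize // size_rcons.
  by apply/eqP => /(congr1 size); rewrite size_rcons; lia.
have [pq'|pq'] /= := boolP (prefix p q).
  have lt := prefix_neq_size pq' pq.
  rewrite ifT; first by rewrite drop_rcons // strict_rcons.
  by apply/eqP => E; move: lt; rewrite E size_rcons; lia.
by rewrite andbN strict1_1.
Qed.

Lemma exc_nil p : exc p [::] = 1 :> R.
Proof. by rewrite /exc prefixs0 andbN. Qed.

Lemma exc_neq1 p q : exc p q <> 1 -> prefix p q /\ (size p < size q)%N.
Proof.
rewrite /exc; case: ifP => // /andP[pq npq] _; split=> //.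
exact: prefix_neq_size.
Qed.

Lemma X_neq1 : psX k <> 1.
Proof. by move=> X1; apply: not_through1; rewrite -X1; apply: through_X. Qed.
Lemma Y_neq1 : psY k <> 1.
Proof. by move=> Y1; apply: not_through1; rewrite -Y1; apply: through_Y. Qed.

(** An axis that is not an exceptional curve gets exponent 0. *)
Definition parent_mult (m : inpoint k -> nat) (o : option (inpoint k)) : nat :=
  if o is Some p then m p else 0.

(** Besides the new exceptional curve, the strict transform of Y = 0 survives in the direction
    [Some 0] and that of X = 0 in the direction [None]; either one then has equation [psY]. In all
    other directions both are left behind. *)
Definition new_Y_parent (px py : option (inpoint k)) d :=
  if d is Some a then (if a == 0 then py else None) else px.

Lemma blowup_monomial d m px py :
  associated
    (psX k ^+ (parent_mult m px + parent_mult m py) *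
     psY k ^+ parent_mult m (new_Y_parent px py d))
    (blowup d (psX k ^+ parent_mult m px * psY k ^+ parent_mult m py)).
Proof.
rewrite rmorphM !rmorphXn /=; case: d => [a|]; rewrite /new_Y_parent.
  rewrite blowup_X_Some blowup_Y_Some exprMn mulrA -exprD.
  apply: associatedM; first exact: associated_refl.
  have [->|a0] := eqVneq a 0; first by rewrite Y_shift0; apply: associated_refl.
  by apply/associated1; rewrite unitrX // Y_shift_unit.
rewrite blowup_X_None blowup_Y_None exprMn exprD mulrAC.
exact: associated_refl.
Qed.

(* The exceptional curves through q are coordinate axes: the last one is the
   Y-axis X = 0, and there is at most one other one, the X-axis Y = 0. *)
Lemma exceptional_structure q : exists px py,
  [/\ forall p, exc p q = psX k <-> px = Some p,
      forall p, exc p q = psY k <-> py = Some p,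
      forall p, through (exc p q) -> exc p q = psX k \/ exc p q = psY k,
      forall f, f != 0 -> associated
        (psX k ^+ parent_mult (fun p => mult_exc p f) px *
         psY k ^+ parent_mult (fun p => mult_exc p f) py * strict q f) (pullback q f)
    & associated (psX k ^+ parent_mult (@canon_exc k) px *
                  psY k ^+ parent_mult (@canon_exc k) py) (canonical_jacobian q)].
Proof.
elim/last_ind: q => [|q d [px [py [Xpx Ypy XY fE JE]]]].
  exists None, None; split=> [p|p|p|f f0|]; rewrite ?exc_nil.
  - by split=> // /esym/X_neq1.
  - by split=> // /esym/Y_neq1.
  - by move/not_through1.
  - by rewrite !mul1r; apply: associated_refl.
  - by rewrite canonical_jacobian_nil mul1r; apply: associated_refl.
have cases p : [\/ px = Some p /\ exc p q = psX k,
                   py = Some p /\ exc p q = psY k | exc p q \is a GRing.unit].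
  have [u|/XY[E|E]] := boolP (exc p q \is a GRing.unit); first exact: Or33.
    by apply: Or31; split=> //; apply/Xpx.
  by apply: Or32; split=> //; apply/Ypy.
have pNpy p : px = Some p -> py <> Some p.
  by move=> /Xpx E /Ypy; rewrite E; apply: X_neq_Y.
have unitN p : exc p q \is a GRing.unit -> px <> Some p /\ py <> Some p.
  by move=> u; split=> [/Xpx E|/Ypy E]; move: u; rewrite E; apply/negP;
    [apply: through_X|apply: through_Y].
have s1 p : [\/ strict1 d (exc p q) = psY k /\ new_Y_parent px py d = Some p
              | strict1 d (exc p q) \is a GRing.unit /\ new_Y_parent px py d <> Some p].
  have [[pE E]|[pE E]|u] := cases p.
  - rewrite E; case: d => [a|] /=; last by left; rewrite strict1_X_None.
    right; rewrite strict1_X_Some unitr1; split=> //.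
    by case: ifP => // _; apply: pNpy.
  - rewrite E; case: d => [a|] /=; last first.
      by right; rewrite strict1_Y_None unitr1; split=> // /pNpy.
    rewrite strict1_Y_Some; case: eqVneq => [->|a0].
      by left; rewrite Y_shift0.
    by right; rewrite Y_shift_unit a0.
  - right; split; first exact: strict1_unit.
    by have [uX uY] := unitN p u; case: d => [a|] //=; case: ifP.
(* By convention [exc q q] is 1, so [q] owns no axis at [q] itself. *)
have notself p : new_Y_parent px py d = Some p -> p <> q.
  move=> E pq; have: exc p q = psX k \/ exc p q = psY k.
    move: E; case: d {s1} => [a|] /=; last by move/Xpx; left.
    by case: ifP => // _ /Ypy; right.
  rewrite pq /exc eqxx andbF => -[/esym/X_neq1 //|/esym/Y_neq1 //].
exists (Some q), (new_Y_parent px py d); split=> [p|p|p|f f0|].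
- rewrite exc_rcons; case: eqVneq => [->|pq]; first by split.
  split=> [E|[E]]; last by rewrite E eqxx in pq.
  case: (s1 p) => -[]; rewrite E; first by move/X_neq_Y.
  by move/negP: through_X.
- rewrite exc_rcons; case: eqVneq => [->|pq].
    by split=> [/X_neq_Y|/notself/(_ erefl)].
  case: (s1 p) => -[E nE]; split=> // YE.
  by move: E; rewrite YE; move/negP: through_Y.
- rewrite exc_rcons; case: eqVneq => _; first by left.
  by case: (s1 p) => -[E _]; [right | rewrite /through E].
- rewrite pullback_rcons strict_rcons /=.
  have [e se] := mult_ord_ex (strict_neq0 q f0).
  (* The order along the new curve is the multiplicity at [q] of the total transform. The
     exceptional curves through [q] are smooth and count with their own orders, and the strict
     transform adds [e]. *)
  have mE : mult_exc q f = (parent_mult (fun p => mult_exc p f) px +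
                            parent_mult (fun p => mult_exc p f) py + e)%N.
    apply: mult_exc_eq; apply: mult_ord_associated (fE f f0) _.
    apply: mult_ordM se; apply: mult_ordM.
      by rewrite -[X in mult_ord _ X]muln1; apply/mult_ordX/mult_ord_X.
    by rewrite -[X in mult_ord _ X]muln1; apply/mult_ordX/mult_ord_Y.
  have [w wU ->] := fE f f0; rewrite rmorphM [X in associated _ (_ * X)]rmorphM /=.
  rewrite -[X in associated X _]mul1r; apply: associatedM.
    by apply/associated1; apply: rmorph_unit.
  rewrite mE (strict1P d se).1 [psX k ^+ (_ + e)]exprD.
  rewrite (_ : _ * _ * _ = (psX k ^+ (parent_mult (fun p => mult_exc p f) px +
    parent_mult (fun p => mult_exc p f) py) *
    psY k ^+ parent_mult (fun p => mult_exc p f) (new_Y_parent px py d)) *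
    (psX k ^+ e * strict1 d (strict q f))).
    apply: associatedM (blowup_monomial _ _ _ _) _; exact: associated_refl.
  by rewrite -!mulrA; congr (_ * _); rewrite mulrCA.
- rewrite canonical_jacobian_rcons /=.
  have jE : canon_exc q = (parent_mult (@canon_exc k) px +
                           parent_mult (@canon_exc k) py).+1%N.
    apply: canon_exc_eq; apply: mult_ord_associated JE _.
    apply: mult_ordM.
      by rewrite -[X in mult_ord _ X]muln1; apply/mult_ordX/mult_ord_X.
    by rewrite -[X in mult_ord _ X]muln1; apply/mult_ordX/mult_ord_Y.
  have [w wU ->] := JE; rewrite [blowup d _]rmorphM /= jE exprS mulrACA.
  rewrite -mulrA -[Z in associated Z _]mul1r; apply: associatedM.
    by apply/associated1; rewrite unitrM rmorph_unit // unitrX ?unitrN1.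
  by apply: associatedM (blowup_monomial _ _ _ _); apply: associated_refl.
Qed.

End ExceptionalCurves.

(** * Log discrepancies and multiplicities of branches *)

Section LogDiscrepancies.
Variable k : closedFieldType.
Local Notation R := (pseries2 k).
Implicit Types (f g h z : R) (d : direction k) (p q : inpoint k) (t : rat).

Lemma nonsingular_mult_ord z : nonsingular z -> mult_ord z 1.
Proof.
move=> [z0 z1]; split=> [[|n] //|].
  by move=> _; apply/polyP => -[|j]; rewrite coef_hform coef0.
by apply/poly_neq0P; case: z1 => z1; [exists 0%N|exists 1%N]; rewrite coef_hform.
Qed.

Lemma transversal_nonsingular z1 z2 :
  transversal z1 z2 -> nonsingular z1 /\ nonsingular z2.
Proof.
move=> [z1_0 z2_0 det]; split; split=> //; apply/orP; apply: contraNT det;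
  by rewrite negb_or !negbK => /andP[/eqP -> /eqP ->]; rewrite !(mul0r, mulr0) subrr.
Qed.

Lemma transversal_sym z1 z2 : transversal z1 z2 -> transversal z2 z1.
Proof.
move=> [z1_0 z2_0 det]; split=> //; rewrite -oppr_eq0 opprB.
by rewrite mulrC [X in _ - X]mulrC.
Qed.

Lemma transversal_XY : transversal (psX k) (psY k).
Proof. by split=> //=; rewrite mulr1 mulr0 subr0 oner_eq0. Qed.

(** Distinct tangent directions: no point of the exceptional curve lies on both strict
    transforms. *)
Lemma transversal_blowup d z1 z2 : transversal z1 z2 ->
  strict1 d z1 \is a GRing.unit \/ strict1 d z2 \is a GRing.unit.
Proof.
move=> tr; have [/nonsingular_mult_ord m1 /nonsingular_mult_ord m2] :=
  transversal_nonsingular tr.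
case: tr => _ _ det; apply/orP; apply: contraNT det.
rewrite negb_or !ps_unitE !negbK (strict1_coef0 _ _ m1) (strict1_coef0 _ _ m2).
case: d => [a|]; last first.
  rewrite !hform_lin_change_None // !coef_hform => /andP[/eqP /= -> /eqP /= ->].
  by rewrite mulr0 mul0r subrr.
have hE z : (hform 1 (lin_change (Some a) z))`_0 = z 1%N 0%N + z 0%N 1%N * a.
  rewrite hform_lin_change_Some -horner_coef0 horner_comp !hornerE.
  rewrite (@horner_coef_wide _ 2 _ _ (size_hform 1 z)).
  by rewrite !big_ord_recl big_ord0 !coef_hform /= expr0 expr1 mulr1 addr0.
rewrite !hE !addr_eq0 => /andP[/eqP -> /eqP ->]; apply/eqP; ring.
Qed.

Lemma transversal_X_strict1 d z : nonsingular z ->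
  strict1 d z \isn't a GRing.unit -> transversal (psX k) (strict1 d z).
Proof.
move=> /nonsingular_mult_ord m1 /nonunitE s0; split=> //=.
rewrite mul1r mul0r subr0; have [_ [j]] := strict1P d m1.
case: j => [|[|j]]; rewrite ?s0 ?eqxx //.
by rewrite (strict1_coef0 _ _ m1) coef_hform eqxx.
Qed.

(* D is a local equation of a divisor with simple normal crossing support, J
   one of the relative canonical divisor, and K - tD has multiplicities > -1. *)
Definition klt_snc t (D J : R) : Prop :=
  exists z1 z2 m1 m2 k1 k2,
    [/\ transversal z1 z2, associated (z1 ^+ m1 * z2 ^+ m2) D,
        associated (z1 ^+ k1 * z2 ^+ k2) J,
        t * m1%:R < k1.+1%:R & t * m2%:R < k2.+1%:R].

Lemma mult_ord_transversal z1 z2 m1 m2 : transversal z1 z2 ->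
  mult_ord (z1 ^+ m1 * z2 ^+ m2) (m1 + m2).
Proof.
move=> /transversal_nonsingular[/nonsingular_mult_ord o1 /nonsingular_mult_ord o2].
have := mult_ordM (mult_ordX m1 o1) (mult_ordX m2 o2).
by rewrite !muln1.
Qed.

(** Blowing up gives a curve of canonical multiplicity [kJ.+1], hence of log discrepancy [kJ.+2],
    which is the sum of [k1.+1] and [k2.+1]. Adding the two local inequalities gives the one for the
    new curve. *)
Lemma klt_snc_mult t D J : klt_snc t D J -> exists m kJ,
  [/\ mult_ord D m, mult_ord J kJ & t * m%:R < kJ.+2%:R].
Proof.
move=> [z1 [z2 [m1 [m2 [k1 [k2 [tr DE JE lt1 lt2]]]]]]].
exists (m1 + m2)%N, (k1 + k2)%N; split.
- exact: mult_ord_associated DE (mult_ord_transversal _ _ tr).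
- exact: mult_ord_associated JE (mult_ord_transversal _ _ tr).
- have -> : ((k1 + k2).+2 = k1.+1 + k2.+1)%N by lia.
  by rewrite !natrD mulrDr ltrD.
Qed.

Lemma blowup_monomial_snc d z1 z2 a b D : nonsingular z1 -> nonsingular z2 ->
  strict1 d z2 \is a GRing.unit -> associated (z1 ^+ a * z2 ^+ b) D ->
  associated (psX k ^+ (a + b) * strict1 d z1 ^+ a) (blowup d D).
Proof.
move=> /nonsingular_mult_ord o1 /nonsingular_mult_ord o2 u2 [w wU ->].
exists (blowup d w * strict1 d z2 ^+ b).
  by rewrite unitrM rmorph_unit // unitrX.
rewrite !rmorphM !rmorphXn /= (strict1P d o1).1 (strict1P d o2).1 !expr1.
by rewrite !exprMn exprD -!mulrA; congr (_ * _); ring.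
Qed.

(** The exceptional curve replaces at least one of the two local branches. The unit [w] absorbs the
    sign of the Jacobian. *)
Lemma klt_snc_blowup t D J d w : w \is a GRing.unit -> klt_snc t D J ->
  klt_snc t (blowup d D) (w * psX k * blowup d J).
Proof.
move=> wU.
suff half z1 z2 m1 m2 k1 k2 : transversal z1 z2 ->
    associated (z1 ^+ m1 * z2 ^+ m2) D -> associated (z1 ^+ k1 * z2 ^+ k2) J ->
    t * m1%:R < k1.+1%:R -> t * m2%:R < k2.+1%:R ->
    strict1 d z2 \is a GRing.unit ->
    klt_snc t (blowup d D) (w * psX k * blowup d J).
  move=> [z1 [z2 [m1 [m2 [k1 [k2 [tr DE JE lt1 lt2]]]]]]].
  have [u|u] := transversal_blowup d tr; last exact: half tr DE JE lt1 lt2 u.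
  by apply: half (transversal_sym tr) _ _ lt2 lt1 u; rewrite mulrC.
move=> tr DE JE lt1 lt2 u2; have [ns1 ns2] := transversal_nonsingular tr.
have D' := blowup_monomial_snc ns1 ns2 u2 DE.
have J' : associated (psX k ^+ (k1 + k2).+1 * strict1 d z1 ^+ k1)
                     (w * psX k * blowup d J).
  have [v vU ->] := blowup_monomial_snc ns1 ns2 u2 JE.
  by exists (w * v); rewrite ?unitrM ?wU // exprS -!mulrA; congr (_ * _);
    rewrite mulrCA.
have lt : t * (m1 + m2)%:R < (k1 + k2).+2%:R.
  have -> : ((k1 + k2).+2 = k1.+1 + k2.+1)%N by lia.
  by rewrite !natrD mulrDr ltrD.
have [u1|u1] := boolP (strict1 d z1 \is a GRing.unit); last first.
  exists (psX k), (strict1 d z1), (m1 + m2)%N, m1, (k1 + k2).+1, k1.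
  by split=> //; apply: transversal_X_strict1.
(* Neither old branch passes through the new point: [psY] with exponents 0 merely completes a
   coordinate system, and its inequality is 0 < 1. *)
exists (psX k), (psY k), (m1 + m2)%N, 0%N, (k1 + k2).+1, 0%N.
rewrite mulr0; split=> //; first exact: transversal_XY.
- apply: associated_trans D'; apply: associatedM; first exact: associated_refl.
  by apply/associated1; rewrite unitrX.
- apply: associated_trans J'; apply: associatedM; first exact: associated_refl.
  by apply/associated1; rewrite unitrX.
Qed.

Implicit Types C : seq (inpoint k).

Lemma configuration_nil C : configuration C -> [::] \in C.
Proof.
move=> [C0 cp]; have C_gt0 : (0 < size C)%N by rewrite lt0n size_eq0.
have [_ pre] := cp 0%N C_gt0; have [E|E] := eqVneq (nth [::] C 0) [::].
  by rewrite -E mem_nth.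
by have := pre [::] (prefix0s _); rewrite eq_sym take0 => /(_ E).
Qed.

Lemma configuration_prefix C p q :
  configuration C -> q \in C -> prefix p q -> p \in C.
Proof.
move=> [_ cp] qC pq; have [-> //|npq] := eqVneq p q.
have iC : (index q C < size C)%N by rewrite index_mem.
have [_ pre] := cp _ iC; rewrite nth_index // in pre.
exact: mem_take (pre p pq npq).
Qed.

Lemma closed_point_rcons C p d : configuration C -> p \in C ->
  rcons p d \notin C -> closed_point C (rcons p d).
Proof.
move=> cC pC qC; split=> // p'; rewrite prefix_rconsE.
by case: eqP => // _; rewrite orbF => pp _; apply: configuration_prefix pp.
Qed.

Lemma closed_pointP C q : configuration C -> closed_point C q ->
  exists p d, q = rcons p d /\ p \in C.
Proof.
move=> cC [qC pre]; case/lastP: q qC pre => [|p d] qC pre.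
  by rewrite configuration_nil in qC.
exists p, d; split=> //; apply: pre; first exact: prefix_rcons.
by apply/eqP => /(congr1 size); rewrite size_rcons; lia.
Qed.

Section Curve.
Variables (I : finType) (c : I -> R) (n : I -> nat).
Hypothesis c_neq0 : forall i, c i != 0.

Definition total_mult p : nat := (\sum_i n i * mult_exc p (c i))%N.
Definition total_eq q : R := \prod_i pullback q (c i) ^+ n i.

Lemma total_eq_rcons q d : total_eq (rcons q d) = blowup d (total_eq q).
Proof.
rewrite /total_eq [RHS]rmorph_prod; apply: eq_bigr => i _.
by rewrite pullback_rcons rmorphXn.
Qed.

Lemma mult_ord_total p : mult_ord (total_eq p) (total_mult p).
Proof. by apply: mult_ord_prod => i; apply/mult_ordX/mult_excP. Qed.

Lemma total_eq_monomial q px py :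
  (forall f, f != 0 -> associated
        (psX k ^+ parent_mult (fun p => mult_exc p f) px *
         psY k ^+ parent_mult (fun p => mult_exc p f) py * strict q f)
        (pullback q f)) ->
  associated (psX k ^+ parent_mult total_mult px *
     psY k ^+ parent_mult total_mult py * \prod_i strict q (c i) ^+ n i)
    (total_eq q).
Proof.
move=> fE; have pmE o : parent_mult total_mult o =
    (\sum_i n i * parent_mult (fun p => mult_exc p (c i)) o)%N.
  by case: o => [p|] //=; rewrite big1 // => i _; rewrite muln0.
apply: associated_trans (associated_prod (fun i => associatedX (n i) (fE _ (c_neq0 i)))).
suff -> : \prod_i (psX k ^+ parent_mult (fun p => mult_exc p (c i)) px *
         psY k ^+ parent_mult (fun p => mult_exc p (c i)) py * strict q (c i)) ^+ n i =
  psX k ^+ parent_mult total_mult px *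
     psY k ^+ parent_mult total_mult py * \prod_i strict q (c i) ^+ n i.
  exact: associated_refl.
under eq_bigr => i _ do rewrite !exprMn -!exprM mulnC [X in psY k ^+ X]mulnC.
by rewrite !big_split !prodrXr !pmE.
Qed.

Variables (C : seq (inpoint k)) (t : rat).
Hypothesis C_res : log_resolution C c.
Hypothesis C_bound : forall p, p \in C -> t * (total_mult p)%:R < (canon_exc p).+1%:R.
Hypothesis c_bound : forall i, t * (n i)%:R < 1.

(** The last exceptional curve passes through [q] with equation [psX]. With no three components
    through a point, at most one further component passes, and it provides the second coordinate. *)
Lemma closed_point_klt q :
  closed_point C q -> klt_snc t (total_eq q) (canonical_jacobian q).
Proof.
have [cC snc] := C_res => qC; have [_ pre] := qC.
have [p [d [qE pC]]] := closed_pointP cC qC.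
have [px [py [Xpx Ypy XY fE JE]]] := exceptional_structure q.
have TE := total_eq_monomial fE.
have pX : exc p q = psX k by rewrite qE exc_rcons eqxx.
have excC p' : exc p' q = psY k -> p' \in C.
  move=> E; have [pp lt] : prefix p' q /\ (size p' < size q)%N.
    by apply: exc_neq1; rewrite E; apply: Y_neq1.
  by apply: pre => //; apply: contraTneq lt => ->; rewrite ltnn.
have pxE : px = Some p by apply/Xpx.
rewrite pxE /= in TE JE.
have [_ tr three] := snc q qC.
have meets_p : in_support C (inl p : inpoint k + I) /\
    through (local_eq c q (inl p)) by rewrite /= pX; split=> //; apply: through_X.
have meets_i i : through (strict q (c i)) ->
  in_support C (inr i : inpoint k + I) /\ through (local_eq c q (inr i)) by [].
have [[i si]|none] := pselect (exists i, through (strict q (c i))).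
  have pyN : py = None.
    case: py Ypy {TE JE fE} => // p' Ypy; have p'Y : exc p' q = psY k by apply/Ypy.
    have meets_p' : in_support C (inl p' : inpoint k + I) /\
      through (local_eq c q (inl p')).
      by rewrite /= p'Y; split; [apply: excC | apply: through_Y].
    case: (three _ _ _ meets_p meets_p' (meets_i i si)); split=> //.
    by apply/eqP => -[pp']; apply: (@X_neq_Y k); rewrite -pX pp'.
  have others i' : i' != i -> strict q (c i') \is a GRing.unit.
    move=> i'i; apply: contraT => si'.
    case: (three _ _ _ meets_p (meets_i i si) (meets_i i' si')); split=> //.
    by rewrite eq_sym.
  exists (psX k), (strict q (c i)), (total_mult p), (n i), (canon_exc p), 0%N.
  split; [|..|exact: C_bound|exact: c_bound].
  - by rewrite -pX; apply: (tr _ _ meets_p (meets_i i si)).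
  - apply: associated_trans TE; rewrite pyN mulr1; apply: associatedM.
      exact: associated_refl.
    rewrite (bigD1 i) //= -[X in associated X]mulr1; apply: associatedM.
      exact: associated_refl.
    by apply/associated1/rpred_prod => i' /others; apply: unitrX.
  - by move: JE; rewrite pyN.
(* No [c i] passes through [q]: the second coordinate is [psY], with the exponents of its
   exceptional curve, or 0 if there is none. *)
exists (psX k), (psY k), (total_mult p), (parent_mult total_mult py),
  (canon_exc p), (parent_mult (@canon_exc k) py).
split=> //; [exact: transversal_XY| |exact: C_bound|].
- apply: associated_trans TE; rewrite -[X in associated X]mulr1.
  apply: associatedM; first exact: associated_refl.
  apply/associated1/rpred_prod => i _; apply: unitrX.
  by apply: contraT => si; case: none; exists i.
- case: py Ypy {TE JE fE} => [p'|] Ypy /=; last by rewrite mulr0.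
  by apply: C_bound; apply: excC; apply/Ypy.
Qed.

Lemma log_discrepancy_bound p : t * (total_mult p)%:R < (canon_exc p).+1%:R.
Proof.
have [cC snc] := C_res.
(* Outside [C] the induction carries the local data, because the numerical bound at one point does
   not by itself pass to the points above it. *)
suff: p \in C \/ klt_snc t (total_eq p) (canonical_jacobian p).
  move=> [/C_bound //|/klt_snc_mult[m [kJ [mE kE]]]].
  by rewrite (mult_ord_inj (mult_ord_total p) mE) (canon_exc_eq kE).
elim/last_ind: p => [|p d [pC|klt]].
- by left; apply: configuration_nil.
- have [|qC] := boolP (rcons p d \in C); first by left.
  by right; apply: closed_point_klt; apply: closed_point_rcons.
- right; rewrite total_eq_rcons canonical_jacobian_rcons.
  by apply: klt_snc_blowup => //; rewrite unitrX ?unitrN1.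
Qed.

End Curve.

End LogDiscrepancies.

(** * Branches transversal to the same exceptional curve have equal multiplicities *)

Section BranchMultiplicities.
Variable k : closedFieldType.
Local Notation R := (pseries2 k).
Implicit Types (f g h z : R) (d : direction k) (p q : inpoint k).
Implicit Types C : seq (inpoint k).

(* Same multiplicity at p and same intersection multiplicity with each of the
   exceptional curves through p. *)
Definition same_contact p h h' : Prop :=
  [/\ forall e, mult_ord h e <-> mult_ord h' e,
      (exists p', exc p' p = psX k) -> forall m, seq_ord (h 0%N) m <-> seq_ord (h' 0%N) m
    & (exists p', exc p' p = psY k) ->
        forall m, seq_ord (h^~ 0%N) m <-> seq_ord (h'^~ 0%N) m].

Lemma seq_ord_congr (s s' : nat -> k) e :
  seq_ord s e -> seq_ord s' e -> forall m, seq_ord s m <-> seq_ord s' m.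
Proof.
by move=> se se' m; split=> [/(seq_ord_inj se) <-|/(seq_ord_inj se') <-].
Qed.

Lemma exc_Y_None p : (exists p', exc p' p = psX k) ->
  exists p', exc p' (rcons p None) = psY k.
Proof.
move=> [p' E]; exists p'; rewrite exc_rcons E strict1_X_None.
by case: eqP E => // ->; rewrite /exc eqxx andbF => /esym/X_neq1.
Qed.

Lemma exc_Y_Some0 p : (exists p', exc p' p = psY k) ->
  exists p', exc p' (rcons p (Some 0)) = psY k.
Proof.
move=> [p' E]; exists p'; rewrite exc_rcons E strict1_Y_Some Y_shift0.
by case: eqP E => // ->; rewrite /exc eqxx andbF => /esym/Y_neq1.
Qed.

(** The multiplicity at [p] is the contact with the new exceptional curve at the next point. The
    contact with an old curve through [p] equals that multiplicity, plus the contact at the next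
    point if the old curve passes through it too: X = 0 does for [d = None], Y = 0 for
    [d = Some 0]. *)
Lemma same_contact_descent p d h h' :
  irreducible_elt h -> irreducible_elt h' ->
  through (strict1 d h) -> through (strict1 d h') ->
  same_contact (rcons p d) (strict1 d h) (strict1 d h') -> same_contact p h h'.
Proof.
move=> hirr hirr' hd hd' [_ sX sY].
have [/mult_ord_ex[e he] _ _] := hirr; have [/mult_ord_ex[e' he'] _ _] := hirr'.
have Xnew : exists p', exc p' (rcons p d) = psX k.
  by exists p; rewrite exc_rcons eqxx.
have ee' : e' = e.
  apply: seq_ord_inj (Y_ord_branch hirr' he' hd') _.
  by apply/sX => //; apply: Y_ord_branch.
subst e'; split.
- by move=> m; split=> [/(mult_ord_inj he) <-|/(mult_ord_inj he') <-].
- move=> Xp; have [dN|dN] := pselect (d = None).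
    subst d; have sY' := sY (exc_Y_None Xp).
    by move=> m; split=> [/(Y_ord_None _ he)|/(Y_ord_None _ he')] [m' -> /sY' o];
      [apply/(Y_ord_None _ he') | apply/(Y_ord_None _ he)]; exists m'.
  exact: seq_ord_congr (Y_ord_not_None hirr he hd dN) (Y_ord_not_None hirr' he' hd' dN).
- move=> Yp; have [d0|d0] := pselect (d = Some 0).
    subst d; have sY' := sY (exc_Y_Some0 Yp).
    by move=> m; split=> [/(X_ord_Some0 _ he)|/(X_ord_Some0 _ he')] [m' -> /sY' o];
      [apply/(X_ord_Some0 _ he') | apply/(X_ord_Some0 _ he)]; exists m'.
  exact: seq_ord_congr (X_ord_not_Some0 hirr he hd d0) (X_ord_not_Some0 hirr' he' hd' d0).
Qed.

Lemma same_contact_prefix p p' h h' :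
  irreducible_elt h -> irreducible_elt h' ->
  through (strict p h) -> through (strict p h') ->
  same_contact p (strict p h) (strict p h') -> prefix p' p ->
  same_contact p' (strict p' h) (strict p' h').
Proof.
move=> hirr hirr'; elim/last_ind: p => [|p d IH] th th' sc.
  by rewrite prefixs0 => /eqP ->.
rewrite prefix_rconsE => /orP[|/eqP -> //]; apply: IH.
- exact: through_strict_prefix (prefix_rcons p d) th.
- exact: through_strict_prefix (prefix_rcons p d) th'.
rewrite !strict_rcons in th th' sc.
apply: (same_contact_descent _ _ th th' sc); apply: irreducible_strict => //.
  by apply: contra th => /(strict1_unit d).
by apply: contra th' => /(strict1_unit d).
Qed.

(** The common feature of a curvette at [p] and of a component with maximal point [p]; the
    comparison of multiplicities sees nothing else of them. *)
Definition transversal_branch C p q (phi : R) : Prop :=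
  [/\ irreducible_elt phi, free_point C p q & transversal (strict q phi) (exc p q)].

Lemma transversal_through z1 z2 : transversal z1 z2 -> through z1.
Proof. by case=> z0 _ _; apply/nonunitE. Qed.

Lemma free_pointE C p q : configuration C -> free_point C p q ->
  p \in C /\ exists d, q = rcons p d.
Proof.
move=> cC [qC pq free]; have [p1 [d [qE p1C]]] := closed_pointP cC qC.
suff -> : p = p1 by split=> //; exists d.
apply: contrapT => /eqP; rewrite eq_sym => /(free _ p1C); apply.
by rewrite qE exc_rcons eqxx; apply: through_X.
Qed.

(** Transversality is contact 1 with the exceptional curve of [p], hence multiplicity 1 at [p]. In
    the direction of an exceptional curve through [p], that curve would pass through the new point
    as well, against freeness. *)
Lemma transversal_branch_mult C p d phi :
  configuration C -> transversal_branch C p (rcons p d) phi ->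
  [/\ mult_ord (strict p phi) 1, through (strict1 d (strict p phi)),
      irreducible_elt (strict p phi),
      (exists p', exc p' p = psX k) -> d <> None
    & (exists p', exc p' p = psY k) -> d <> Some 0].
Proof.
move=> cC [pirr [[qC pre] pq fr] tr].
have th := transversal_through tr; rewrite strict_rcons in th tr.
have sirr : irreducible_elt (strict p phi).
  by apply: irreducible_strict => //; apply: contra th => /(strict1_unit d).
have noY p' : exc p' (rcons p d) <> psY k.
  move=> E; have [pp lt] : prefix p' (rcons p d) /\ (size p' < size (rcons p d))%N.
    by apply: exc_neq1; rewrite E; apply: Y_neq1.
  apply: (fr p'); last by rewrite E; apply: through_Y.
    by apply: pre => //; apply: contraTneq lt => ->; rewrite ltnn.
  by apply/eqP => pp'; move: E; rewrite pp' exc_rcons eqxx => /X_neq_Y.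
split=> //.
- have [/mult_ord_ex[e he] _ _] := sirr.
  suff -> : 1%N = e by [].
  apply: seq_ord_inj (Y_ord_branch sirr he th).
  case: tr => s0 _; rewrite exc_rcons eqxx /= mulr0 sub0r mulr1 oppr_eq0 => s1.
  by split=> // -[].
- by move=> Xp dN; subst d; have [p' /noY] := exc_Y_None Xp.
- by move=> Yp d0; subst d; have [p' /noY] := exc_Y_Some0 Yp.
Qed.

(** Both germs are smooth at [p] and tangent to no exceptional curve there, so all contacts are 1,
    whichever free points they go through. *)
Lemma transversal_branch_contact C p q q' phi psi : configuration C ->
  transversal_branch C p q phi -> transversal_branch C p q' psi ->
  same_contact p (strict p phi) (strict p psi).
Proof.
move=> cC tb tb'; have [_ free _] := tb; have [_ free' _] := tb'.
have [_ [d E]] := free_pointE cC free; have [_ [d' E']] := free_pointE cC free'.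
subst q q'; have [m t i X Y] := transversal_branch_mult cC tb.
have [m' t' i' X' Y'] := transversal_branch_mult cC tb'; split.
- by move=> e; split=> [/(mult_ord_inj m) <-|/(mult_ord_inj m') <-].
- move=> Xp; apply: seq_ord_congr (Y_ord_not_None i' m' t' (X' Xp)).
  exact: Y_ord_not_None i m t (X Xp).
- move=> Yp; apply: seq_ord_congr (X_ord_not_Some0 i' m' t' (Y' Yp)).
  exact: X_ord_not_Some0 i m t (Y Yp).
Qed.

Lemma transversal_branch_prefix C p q p' phi : configuration C ->
  transversal_branch C p q phi -> p' \in C -> through (strict p' phi) ->
  prefix p' p.
Proof.
move=> cC [pirr free tr] p'C th; have [pC [d E]] := free_pointE cC free.
have [[qC pre] _ _] := free; subst q.
have [] := branch_points_comparable pirr th (transversal_through tr).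
  by rewrite prefix_rconsE => /orP[//|/eqP p'E]; rewrite -p'E p'C in qC.
by move/(configuration_prefix cC p'C) => qC'; rewrite qC' in qC.
Qed.

(** The order along the exceptional curve of [q] is the multiplicity of the strict transform at [q]
    plus the orders along the exceptional curves through [q], which belong to proper prefixes of
    [q]. *)
Lemma mult_exc_of_mult_strict q phi psi : phi != 0 -> psi != 0 ->
  (forall p, prefix p q ->
     forall e, mult_ord (strict p phi) e <-> mult_ord (strict p psi) e) ->
  mult_exc q phi = mult_exc q psi.
Proof.
move=> phi0 psi0; move: {2}(size q).+1 (ltnSn (size q)) => N.
elim: N q => // N IH q qN same.
have [px [py [Xpx Ypy _ fE _]]] := exceptional_structure q.
have [e se] := mult_ord_ex (strict_neq0 q phi0).
have se' := (same q (prefix_refl q) e).1 se.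
have mE f : f != 0 -> mult_ord (strict q f) e ->
    mult_exc q f = (parent_mult (fun p => mult_exc p f) px +
                    parent_mult (fun p => mult_exc p f) py + e)%N.
  move=> f0 fe; apply: mult_exc_eq; apply: mult_ord_associated (fE f f0) _.
  by apply: mult_ordM fe; apply: mult_ord_transversal; apply: transversal_XY.
have parent p : exc p q <> 1 -> mult_exc p phi = mult_exc p psi.
  move=> /exc_neq1[pq lt]; apply: IH; first by apply: leq_trans lt _.
  by move=> p' p'p; apply: same; apply: prefix_trans pq.
rewrite !mE //; congr (_ + _ + _)%N.
- case: px Xpx {fE mE} => //= p Xpx; apply: parent.
  by rewrite (Xpx p).2 //; apply: X_neq1.
- case: py Ypy {fE mE} => //= p Ypy; apply: parent.
  by rewrite (Ypy p).2 //; apply: Y_neq1.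
Qed.

Lemma transversal_branch_mult_exc C p q q' p' phi psi : configuration C ->
  transversal_branch C p q phi -> transversal_branch C p q' psi -> p' \in C ->
  mult_exc p' phi = mult_exc p' psi.
Proof.
move=> cC tb tb' p'C; have [irr free tr] := tb; have [irr' free' tr'] := tb'.
have [[phi0 _ _] [psi0 _ _]] := (irr, irr').
apply: mult_exc_of_mult_strict => // p1 p1p'.
have p1C := configuration_prefix cC p'C p1p'.
have [p1p|p1p] := boolP (prefix p1 p).
  have th q1 f : transversal_branch C p q1 f -> through (strict p f).
    move=> [_ fr1 tr1]; have [_ [d E]] := free_pointE cC fr1; subst q1.
    exact: through_strict_prefix (prefix_rcons p d) (transversal_through tr1).
  by have [] := same_contact_prefix irr irr' (th _ _ tb) (th _ _ tb')
    (transversal_branch_contact cC tb tb') p1p.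
(* A point of [C] that is not a prefix of [p] lies on neither branch: both multiplicities are 0. *)
have unit_at q1 f : transversal_branch C p q1 f -> mult_ord (strict p1 f) 0.
  move=> tbf; apply/mult_ord_unit; apply: contraNT p1p => th.
  exact: transversal_branch_prefix cC tbf p1C th.
have [u u'] := (unit_at _ _ tb, unit_at _ _ tb').
by move=> e; split=> [/(mult_ord_inj u) <-|/(mult_ord_inj u') <-].
Qed.

End BranchMultiplicities.

(** * Thresholds *)

Section Thresholds.
Variable k : closedFieldType.
Local Notation R := (pseries2 k).
Implicit Types (p q : inpoint k) (C : seq (inpoint k)) (s t : rat).

Lemma lt_bigminP (T : eqType) (x s : rat) (r : seq T) (P : pred T) (F : T -> rat) :
  s < \big[Num.min/x]_(i <- r | P i) F i <->
  s < x /\ forall i, i \in r -> P i -> s < F i.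
Proof.
elim: r => [|a r IH]; first by rewrite big_nil; split=> [|[]].
rewrite big_cons; case: ifP => Pa; rewrite ?lt_min; split.
- move=> /andP[sa /IH[sx sr]]; split=> // i.
  by rewrite inE => /predU1P[-> //|]; apply: sr.
- move=> [sx sr]; rewrite sr ?mem_head //=; apply/IH; split=> // i ir.
  by apply: sr; rewrite inE ir orbT.
- move=> /IH[sx sr]; split=> // i.
  by rewrite inE => /predU1P[->|]; [rewrite Pa|apply: sr].
- move=> [sx sr]; apply/IH; split=> // i ir.
  by apply: sr; rewrite inE ir orbT.
Qed.

Lemma floor_le_nat (x : rat) (m : nat) : (Num.floor x <= m%:Z) = (x < m.+1%:R).
Proof. by rewrite -ltzD1 floor_lt_int -natr1 intrD. Qed.

Section Curve.
Variables (I : finType) (c : I -> R) (n : I -> nat).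
Hypothesis c_irr : forall i, irreducible_elt (c i).

(** It quantifies over all infinitely near points and mentions no resolution, so any two log
    resolutions can be compared through it. *)
Definition klt_pair t : Prop :=
  (forall p, t * (total_mult c n p)%:R < (canon_exc p).+1%:R) /\
  (forall i, t * (n i)%:R < 1).

Lemma klt_pairP C t : log_resolution C c ->
  klt_pair t <->
  (forall p, p \in C -> t * (total_mult c n p)%:R < (canon_exc p).+1%:R) /\
  (forall i, t * (n i)%:R < 1).
Proof.
move=> res; split=> [[bE bc]|[bE bc]]; split=> // p.
by apply: log_discrepancy_bound res bE bc p => i; case: (c_irr i).
Qed.

Lemma ord_along1 i : ord_along (c i) 1 = 0%N.
Proof.
have [_ cU _] := c_irr i.
have no e : ~ divides (c i ^+ e.+1) 1.
  move=> [a aE]; move: cU; apply/negP/negPn.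
  by apply/unitrPr; exists (c i ^+ e * a); rewrite mulrA -exprS -aE.
apply: xget_unique => /= [|e [[a aE] _]].
  by split; [exists 1; rewrite mulr1|apply: no].
by case: e aE => // e aE; case: (no e); exists a.
Qed.

(** It suffices to test 1, whose order along every divisor is 0; conversely the inequalities make
    all the floors small enough for any [h], orders being natural numbers. *)
Lemma multiplier_ideal_setT C t : log_resolution C c ->
  multiplier_ideal C c n t = setT <-> klt_pair t.
Proof.
move=> res; rewrite (klt_pairP _ res); split=> [JT|[bE bc]].
  have : multiplier_ideal C c n t 1 by rewrite JT.
  case=> [/eqP|[bE bc]]; first by rewrite oner_eq0.
  split=> [p pC|i].
    have := bE p pC; rewrite (@mult_exc_eq _ p 1 0) ?add0r ?floor_le_nat //.
    by rewrite pullback1; apply/mult_ord_unit/unitr1.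
  by have := bc i; rewrite ord_along1 (floor_le_nat _ 0).
apply/predeqP => h; split=> // _; right; split=> [p pC|i].
  apply: (@le_trans _ _ (canon_exc p)%:Z); last by rewrite lerDr.
  by rewrite floor_le_nat; apply: bE.
apply: (@le_trans _ _ 0%:Z) => //.
by rewrite floor_le_nat; apply: bc.
Qed.

Lemma is_lct_klt C t : log_resolution C c -> 0 < t ->
  (forall s, 0 < s -> klt_pair s <-> s < t) -> is_lct c n t.
Proof.
move=> res t0 kltP; split; first by exists C.
move=> C' res'; split=> //.
  by move/(multiplier_ideal_setT _ res')/(kltP t t0); rewrite ltxx.
move=> s s0 sT; rewrite leNgt; apply/negP => /(kltP s s0) klt.
by apply/sT/(multiplier_ideal_setT _ res').
Qed.

Lemma is_lct_unique t t' : is_lct c n t -> is_lct c n t' -> t = t'.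
Proof.
move=> [[C res] lct] [_ lct'].
have [t0 tT tmin] := lct C res; have [t'0 t'T t'min] := lct' C res.
by apply/le_anti; rewrite tmin ?t'min.
Qed.

End Curve.

(** The cap 1 is the bound imposed by components of multiplicity 1. Exceptional curves of total
    multiplicity 0 impose nothing and would cause a division by 0, hence the filter. *)
Definition threshold_on C (I : finType) (c : I -> R) (n : I -> nat) : rat :=
  \big[Num.min/1]_(p <- C | (0 < total_mult c n p)%N)
    ((canon_exc p).+1%:R / (total_mult c n p)%:R).

Lemma lt_threshold_on C (I : finType) (c : I -> R) (n : I -> nat) s :
  s < threshold_on C c n <->
  s < 1 /\ forall p, p \in C -> s * (total_mult c n p)%:R < (canon_exc p).+1%:R.
Proof.
rewrite lt_bigminP; split=> -[s1 sC]; split=> // p pC.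
  have [N0|N_gt0] := posnP (total_mult c n p).
    by rewrite N0 mulr0 ltr0Sn.
  by rewrite -ltr_pdivlMr ?ltr0n // sC.
by move=> N_gt0; rewrite ltr_pdivlMr ?ltr0n // sC.
Qed.

Lemma threshold_on_gt0 C (I : finType) (c : I -> R) (n : I -> nat) :
  0 < threshold_on C c n.
Proof. by apply/lt_threshold_on; split=> // p _; rewrite mul0r ltr0Sn. Qed.

End Thresholds.

(** * Curvettes on the given log resolution *)

Section Curvettes.
Variable k : closedFieldType.
Local Notation R := (pseries2 k).
Implicit Types (p q : inpoint k) (C : seq (inpoint k)).

Lemma closed_point_prefix C q q' :
  closed_point C q -> closed_point C q' -> prefix q q' -> q = q'.
Proof.
move=> [qC _] [_ pre] qq'; apply: contrapT => /eqP ne.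
by rewrite (pre q qq' ne) in qC.
Qed.

Lemma branch_closed_point C q q' (phi : R) : irreducible_elt phi ->
  closed_point C q -> closed_point C q' ->
  through (strict q phi) -> through (strict q' phi) -> q = q'.
Proof.
move=> irr qC q'C th th'; have [|] := branch_points_comparable irr th th'.
  exact: closed_point_prefix qC q'C.
by move=> /(closed_point_prefix q'C qC).
Qed.

Lemma through_associated q (phi psi : R) : phi != 0 -> associated phi psi ->
  through (strict q psi) -> through (strict q phi).
Proof.
move=> phi0 [w wU ->]; rewrite strictM //; last first.
  by apply: contraTneq wU => ->; rewrite unitr0.
by rewrite /through unitrM (strict_unit q wU).
Qed.

(** The branch continues in some direction, and maximality puts that next point outside [C]. There
    normal crossings give transversality to the exceptional curve of [p], and the exclusion of a
    third component makes the point free. *)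
Lemma transversal_branch_of_maximal C (I : finType) (c : I -> R) i p :
  irreducible_elt (c i) -> log_resolution C c -> maximal_point C (c i) p ->
  exists q, transversal_branch C p q (c i).
Proof.
move=> irr [cC snc] [pC th max]; have [c0 _ _] := irr.
have [d thd] := direction_ex (strict_neq0 p c0) th.
rewrite -strict_rcons in thd.
have qC : rcons p d \notin C.
  apply/negP => qC; have := max _ qC thd (prefix_rcons p d).
  by move/(congr1 size); rewrite size_rcons; lia.
have qcl := closed_point_rcons cC pC qC.
have pX : exc p (rcons p d) = psX k by rewrite exc_rcons eqxx.
have [_ tr three] := snc _ qcl.
have mi : in_support C (inr i : inpoint k + I) /\
  through (local_eq c (rcons p d) (inr i)) by [].
have mp : in_support C (inl p : inpoint k + I) /\
  through (local_eq c (rcons p d) (inl p)).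
  by rewrite /= pX; split=> //; apply: through_X.
exists (rcons p d); split=> //; last exact: (tr _ _ mi mp).
split=> //; first exact: mp.2.
move=> p' p'C p'p th'; have mp' : in_support C (inl p' : inpoint k + I) /\
  through (local_eq c (rcons p d) (inl p')) by [].
by apply: (three _ _ _ mi mp mp'); split=> //; apply: contra p'p => /eqP[->].
Qed.

Lemma curvette_transversal_branch C (I : finType) (c : I -> R) p phi :
  curvette C c p phi -> exists q, transversal_branch C p q phi.
Proof. by move=> [irr _ _ [q free tr]]; exists q. Qed.

Section DistinctFreePoints.
Variables (I : finType) (J : finType) (f : I -> R) (g : J -> R) (j : J -> inpoint k).
Variable C : seq (inpoint k).
Hypothesis f_res : log_resolution C f.
Hypothesis g_curv : forall x, curvette C f (j x) (g x).
Hypothesis g_free : forall x y, x != y -> j x = j y -> forall q,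
  free_point C (j x) q -> ~ (through (strict q (g x)) /\ through (strict q (g y))).

Let g_irr x : irreducible_elt (g x). Proof. by case: (g_curv x). Qed.

Let g_at x q : closed_point C q -> through (strict q (g x)) ->
  free_point C (j x) q /\ transversal (strict q (g x)) (exc (j x) q).
Proof.
move=> qC th; have [_ _ _ [q' free tr]] := g_curv x.
have [q'C _ _] := free.
by rewrite (branch_closed_point (g_irr x) qC q'C th (transversal_through tr)).
Qed.

(** A free point lies on one exceptional curve only. Hence [g_free], which compares only curvettes
    at the same point of [C], separates all of them. *)
Let free_eq x y q : free_point C (j x) q -> free_point C (j y) q -> j x = j y.
Proof.
move=> fx [_ thy fy]; have [jxC _] := free_pointE f_res.1 fx.
have [_ thx _] := fx.
by apply: contrapT => /eqP ne; apply: (fy _ jxC ne).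
Qed.

Let g_separated x y q : closed_point C q ->
  through (strict q (g x)) -> through (strict q (g y)) -> x = y.
Proof.
move=> qC thx thy; apply: contrapT => /eqP xy.
have [fx _] := g_at qC thx; have [fy _] := g_at qC thy.
by apply: (g_free xy (free_eq fx fy) fx).
Qed.

Lemma curvettes_components : components g.
Proof.
split=> // x y xy ass; have [_ _ _ [q free tr]] := g_curv y.
have [qC _ _] := free; have [gx0 _ _] := g_irr x.
have thy := transversal_through tr.
have thx := through_associated gx0 ass thy.
by rewrite (g_separated qC thx thy) eqxx in xy.
Qed.

(** Crossings among exceptional curves are inherited from [f_res]. At a closed point on [g x] the
    only other component is the exceptional curve of [j x], by freeness and separation, so each
    condition splits according to whether a curvette is involved. *)
Lemma curvettes_log_resolution : log_resolution C g.
Proof.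
have [cC snc] := f_res; split=> // q qC; have [ns tr three] := snc q qC.
have only x (D : inpoint k + J) : through (strict q (g x)) ->
    in_support C D /\ through (local_eq g q D) -> D != inr x -> D = inl (j x).
  move=> thx; case: D => [p|y] /= [pC th] ne.
    have [[_ _ free] _] := g_at qC thx; congr inl.
    by apply: contrapT => /eqP /(free _ pC).
  by rewrite (g_separated qC th thx) eqxx in ne.
split.
- move=> [p|x] /= [pC th]; first exact: (ns (inl p)).
  by have [_ _ cns _] := g_curv x; apply: cns.
- have mixed x (D : inpoint k + J) : through (strict q (g x)) ->
      in_support C D /\ through (local_eq g q D) -> D != inr x ->
      transversal (strict q (g x)) (local_eq g q D).
    move=> th mD /(only x D th mD) ->; exact: (g_at qC th).2.
  move=> [p|x] D' mD mD' ne; last by apply: mixed => //; [exact: mD.2|rewrite eq_sym].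
  case: D' mD' ne => [p'|y] mD' ne; first exact: (tr (inl p) (inl p')).
  by apply: transversal_sym; apply: (mixed y (inl p)) => //; exact: mD'.2.
- have two x (D D' : inpoint k + J) : through (strict q (g x)) ->
      in_support C D /\ through (local_eq g q D) ->
      in_support C D' /\ through (local_eq g q D') ->
      D != inr x -> D' != inr x -> D = D'.
    by move=> th mD mD' /(only x D th mD) -> /(only x D' th mD') ->.
  move=> D D' D'' mD mD' mD'' [n1 n2 n3].
  case: D mD n1 n3 => [p|x] mD n1 n3; last first.
    by case/eqP: n2; apply: (two x) => //; [exact: mD.2|rewrite eq_sym..].
  case: D' mD' n1 n2 => [p'|x] mD' n1 n2; last first.
    by case/eqP: n3; apply: (two x) => //; [exact: mD'.2|rewrite eq_sym].
  case: D'' mD'' n2 n3 => [p''|x] mD'' n2 n3; last first.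
    by case/eqP: n1; apply: (two x) => //; exact: mD''.2.
  by apply: (three (inl p) (inl p') (inl p'')).
Qed.

End DistinctFreePoints.

Lemma singular_mul (a b : R) : a 0%N 0%N = 0 -> b 0%N 0%N = 0 -> singular (a * b).
Proof.
move=> a0 b0; split; rewrite coef_mul !big_ord_recl !big_ord0 /= ?a0 ?b0;
  by rewrite ?(mul0r, mulr0, addr0).
Qed.

End Curvettes.

(* g (i, l) is the equation of the curve C_{il}, for l < n_i. *)
Theorem mainTheorem3 (k : closedFieldType) (r : nat)
    (f : 'I_r -> pseries2 k) (n : 'I_r -> nat) (C : seq (inpoint k))
    (j : 'I_r -> inpoint k) (g : {i : 'I_r & 'I_(n i)} -> pseries2 k) :
  components f ->
  (forall i, 0 < n i)%N ->
  (exists i, 1 < n i)%N ->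
  log_resolution C f ->
  (forall i, maximal_point C (f i) (j i)) ->
  (forall x, curvette C f (j (tag x)) (g x)) ->
  (forall x y, x != y -> j (tag x) = j (tag y) ->
     forall q, free_point C (j (tag x)) q ->
       ~ (through (strict q (g x)) /\ through (strict q (g y)))) ->
  [/\ components g,
      exists2 c' : rat, is_lct g (fun=> 1%N) c' &
        is_lct f n (\big[Num.min/c']_i (n i)%:R^-1) &
      forall F : forall I : finType, (I -> pseries2 k) -> rat,
        (forall (I : finType) (c : I -> pseries2 k),
           components c -> singular (\prod_i c i) ->
           is_lct c (fun=> 1%N) (F I c)) ->
        is_lct f n (\big[Num.min/F _ g]_i (n i)%:R^-1)].
Proof.
move=> [f_irr _] n_gt0 [i0 n_i0] f_res f_max g_curv g_free.
have g_comp := curvettes_components f_res g_curv g_free.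
have g_res := curvettes_log_resolution f_res g_curv g_free.
have [g_irr _] := g_comp.
have multE p : p \in C -> total_mult g (fun=> 1%N) p = total_mult f n p.
  move=> pC; rewrite /total_mult.
  transitivity (\sum_(x : {i : 'I_r & 'I_(n i)}) mult_exc p (f (tag x)))%N.
    apply: eq_bigr => x _; rewrite mul1n.
    have [q tb] := curvette_transversal_branch (g_curv x).
    have [q' tb'] := transversal_branch_of_maximal (f_irr _) f_res (f_max (tag x)).
    exact: transversal_branch_mult_exc f_res.1 tb tb' pC.
  rewrite -(@sig_big_dep _ _ addn _ _ xpredT (fun _ => xpredT)
    (fun i _ => mult_exc p (f i))) /=.
  by apply: eq_bigr => i _; rewrite sum_nat_const card_ord.
pose c' := threshold_on C g (fun=> 1%N).
have lct_g : is_lct g (fun=> 1%N) c'.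
  apply: (is_lct_klt g_irr g_res (threshold_on_gt0 _ _ _)) => s s0.
  rewrite lt_threshold_on (klt_pairP _ g_irr _ g_res).
  split=> -[]; [move=> bE bc|move=> s1 bE]; split=> //.
    (* The cap [s < 1] comes from any one curve of C'; [n_gt0] supplies one over [i0]. *)
    by have := bc (Tagged (fun i => 'I_(n i)) (Ordinal (n_gt0 i0))); rewrite mulr1.
  by move=> x; rewrite mulr1.
have lct_f : is_lct f n (\big[Num.min/c']_i (n i)%:R^-1).
  apply: (is_lct_klt f_irr f_res) => [|s s0].
    apply/lt_bigminP; split=> [|i _ _]; first exact: threshold_on_gt0.
    by rewrite invr_gt0 ltr0n.
  have ltV i : (s < (n i)%:R^-1) = (s * (n i)%:R < 1).
    by rewrite -[_^-1]mul1r ltr_pdivlMr // ltr0n.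
  rewrite lt_bigminP lt_threshold_on (klt_pairP _ f_irr _ f_res).
  split=> [[bE bc]|[[s1 bE] bc]]; split.
  (* The cap 1 in [c'] is implied by the bounds on the components: s <= s n_i0 < 1. *)
  - split=> [|p pC]; last by rewrite multE //; apply: bE.
    apply: le_lt_trans (bc i0).
    by apply: ler_peMr; [apply: ltW | rewrite ler1n].
  - by move=> i _ _; rewrite ltV.
  - by move=> p pC; rewrite -multE //; apply: bE.
  - by move=> i; rewrite -ltV bc // mem_index_enum.
split=> //; first by exists c'.
move=> F F_lct; suff -> : F _ g = c' by [].
apply: is_lct_unique lct_g; apply: F_lct => //.
(* As n_i0 > 1, there are two distinct curvettes over [i0]. Both equations vanish at the closed
   point, so the product is singular and [F] applies to C'. *)
pose x : {i : 'I_r & 'I_(n i)} := Tagged (fun i => 'I_(n i)) (Ordinal (n_gt0 i0)).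
pose y : {i : 'I_r & 'I_(n i)} := Tagged (fun i => 'I_(n i)) (Ordinal n_i0).
have g00 z : g z 0%N 0%N = 0 by apply/nonunitE; case: (g_irr z).
rewrite (bigD1 x) //=; apply: singular_mul; first exact: g00.
rewrite (bigD1 y); first by rewrite coef_mul00 g00 mul0r.
by rewrite /= eq_Tagged.
Qed.
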